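(* 1. (Duality principle) For any quasi-poset $P$: $$ehr^{str}_P(X)=(-1)^{cl(P)}ehr_P(-X).$$ 2. For any quasi-poset $P$, $\alpha_P=(-1)^{cl(P)+cc(P)}\alpha^{str}_P$. 3. $\alpha$ is invertible in $M_{\mathbf{qp}}$. Denoting its inverse by $\beta$, for any quasi-poset $P$: $$\beta_P=(-1)^{cl(P)+cc(P)}\lambda_P=(-1)^{cl(P)+cc(P)}\frac{\mu_P}{cl(P)!}.$$
   Context: $\mathbb{K}$ is a field of characteristic zero. A quasi-poset is a pair $P=(A,\leq_P)$ with $A$ finite and $\leq_P$ reflexive and transitive; $x\sim_Py$ means $x\leq_Py$ and $y\leq_Px$; $\overline{P}$ is the quotient poset on $A/\sim_P$, and $cl(P)$ is its cardinality; $\lfloor P\rfloor$ is the isoclass; $P_{\mid B}$ is the restriction to $B\subseteq A$; $top(P)$ is the topology of open sets, i.e. subsets $O$ with ($i\in O$, $i\leq_Pj$)$\Rightarrow j\in O$; $P$ is connected if this topology is connected, and $cc(P)$ is the number of connected components. $P$ is discrete if $\leq_P$ equals $\sim_P$. For an equivalence $\sim$ on $A$: $x\leq_{P|\sim}y$ iff $x\leq_Py$ and $x\sim y$; $\leq_{P/\sim}$ is the transitive closure of the relation ($x\leq_Py$ or $x\sim y$); these are quasi-posets $P|\sim$ and $P/\sim$ on $A$. We write $\sim\triangleleft P$ if the restriction of $P$ to each class of $\sim$ is connected and $\sim_{P/\sim}$ equals $\sim$. $\mathcal{H}_{\mathbf{qp}}$ is the $\mathbb{K}$-vector space with basis the set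 of isoclasses of quasi-posets, with product $m$ given by disjoint union (unit: empty quasi-poset), and coproducts $\Delta(\lfloor P\rfloor)=\sum_{O\in top(P)}\lfloor P_{\mid A\setminus O}\rfloor\otimes\lfloor P_{\mid O}\rfloor$ and $\delta(\lfloor P\rfloor)=\sum_{\sim\triangleleft P}\lfloor P/\sim\rfloor\otimes\lfloor P|\sim\rfloor$. $(\mathcal{H}_{\mathbf{qp}},m,\Delta)$ is a Hopf algebra, graded by $cl$; $(\mathcal{H}_{\mathbf{qp}},m,\delta)$ is a bialgebra with counit $\varepsilon'$, $\varepsilon'(\lfloor P\rfloor)=1$ if $P$ is discrete and $0$ otherwise. $\mathbb{K}[X]$ has its usual product, grading and coproduct $\Delta(X)=X\otimes1+1\otimes X$. $M_{\mathbf{qp}}$ is the monoid of characters (algebra morphisms to $\mathbb{K}$) of $\mathcal{H}_{\mathbf{qp}}$ with product $\lambda*\mu=(\lambda\otimes\mu)\circ\delta$ and unit $\varepsilon'$; for a character $\lambda$ write $\lambda_P=\lambda(\lfloor P\rfloor)$. For a Hopf algebra morphism $\phi:(\mathcal{H}_{\mathbf{qp}},m,\Delta)\to(\mathbb{K}[X],m,\Delta)$ and $\lambda\in M_{\mathbf{qp}}$, $\phi\leftarrow\lambda=(\phi\otimes\lambda)\circ\delta$. For $k\ge1$, $L_P(k)$ is the set of maps $f:A\to\{1,\ldots,k\}$ with $i\leq_Pj\Rightarrow f(i)\leq f(j)$, and $L^{str}_P(k)$ the set of $f\in L_P(k)$ such that ($i\leq_Pj$ and $f(i)=f(j)$)$\Rightarrow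 i\sim_Pj$. $ehr_P$, $ehr_P^{str}$ are the unique polynomials with $ehr_P(k)=\sharp L_P(k)$, $ehr_P^{str}(k)=\sharp L_P^{str}(k)$ for all $k\geq1$; $ehr,ehr^{str}:\mathcal{H}_{\mathbf{qp}}\to\mathbb{K}[X]$ are the corresponding linear maps (Hopf algebra morphisms for $\Delta$). $\phi_0$ is the unique homogeneous Hopf algebra morphism $(\mathcal{H}_{\mathbf{qp}},m,\Delta)\to(\mathbb{K}[X],m,\Delta)$ sending, for every $n\ge1$, the isoclass of the quasi-poset with $n$ pairwise equivalent elements to $X$. $\lambda\in M_{\mathbf{qp}}$ is the unique character with $\phi_0(\lfloor P\rfloor)=\lambda_PX^{cl(P)}$ for all $P$; $\alpha,\alpha^{str}\in M_{\mathbf{qp}}$ are the unique characters with $ehr=\phi_0\leftarrow\alpha$ and $ehr^{str}=\phi_0\leftarrow\alpha^{str}$. $\mu_P$ is the number of heap-orderings of $P$, i.e. the number of bijections $f:\overline{P}\to\{1,\ldots,cl(P)\}$ with $x\leq_{\overline P}y\Rightarrow f(x)\leq f(y)$. *)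

(* Defs.v *)
From HB Require Import structures.
From mathcomp Require Import all_boot all_order all_algebra.
From mathcomp Require Export finmap monalg.

Set Implicit Arguments.
Unset Strict Implicit.
Unset Printing Implicit Defensive.

Import GRing.Theory.
Local Open Scope ring_scope.
Local Open Scope quotient_scope.

(* The relation is stored as its graph, so that quasi-posets on A form a
   finType and are equal as soon as their relations agree pointwise. *)
Definition is_qorder (A : finType) (R : {set A * A}) : bool :=
  [forall x, (x, x) \in R] &&
  [forall x, forall y, forall z,
     ((x, y) \in R) && ((y, z) \in R) ==> ((x, z) \in R)].

Record qposet (A : finType) :=
  QPoset { qgraph :> {set A * A}; _ : is_qorder qgraph }.

HB.instance Definition _ (A : finType) := [isSub for @qgraph A].
HB.instance Definition _ (A : finType) := [Finite of qposet A by <:].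

Definition qle (A : finType) (P : qposet A) : rel A :=
  fun x y => (x, y) \in qgraph P.

Coercion qle : qposet >-> rel.

Section QposetBasics.
Variable A : finType.
Implicit Types P Q : qposet A.

Lemma qle_refl P : reflexive P.
Proof. by rewrite /qle => x; case: P => R /= /andP[/forallP]. Qed.

Lemma qle_trans P : transitive P.
Proof.
rewrite /qle => y x z; case: P => R /= /andP[_ /'forall_forallP/(_ x y)].
by move=> /forallP/(_ z)/implyP tr xy yz; apply: tr; rewrite xy.
Qed.

Lemma qposetP P Q : (forall x y, P x y = Q x y) -> P = Q.
Proof. by move=> PQ; apply/val_inj/setP => -[x y]; apply: PQ. Qed.

Variables (r : rel A) (r_refl : reflexive r) (r_trans : transitive r).

Lemma mk_qposet_subproof : is_qorder [set xy : A * A | r xy.1 xy.2].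
Proof.
apply/andP; split; first by apply/forallP => x; rewrite inE.
apply/'forall_forallP => x y; apply/forallP => z; rewrite !inE /=.
by apply/implyP => /andP[]; apply: r_trans.
Qed.

Definition mk_qposet : qposet A := QPoset mk_qposet_subproof.

Lemma mk_qposetE x y : mk_qposet x y = r x y.
Proof. by rewrite /qle inE. Qed.

End QposetBasics.

Section Constructions.

Section Pullback.
Variables (A B : finType) (f : A -> B) (P : qposet B).
Let r := [rel x y | P (f x) (f y)].
Fact qpull_refl : reflexive r. Proof. by move=> x; apply: qle_refl. Qed.
Fact qpull_trans : transitive r.
Proof. by move=> y x z; apply: qle_trans. Qed.
Definition qpull : qposet A := mk_qposet qpull_refl qpull_trans.
Lemma qpullE x y : qpull x y = P (f x) (f y).
Proof. exact: mk_qposetE. Qed.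
End Pullback.

Definition qrestr (A : finType) (P : qposet A) (B : {set A}) :
  qposet {x : A | x \in B} := qpull val P.

Section DisjointUnion.
Variables (A B : finType) (P : qposet A) (Q : qposet B).
Let r (x y : A + B) : bool :=
  match x, y with
  | inl a, inl a' => P a a'
  | inr b, inr b' => Q b b'
  | _, _ => false
  end.
Fact qsum_refl : reflexive r. Proof. by case=> x; apply: qle_refl. Qed.
Fact qsum_trans : transitive r.
Proof. by case=> y [] x [] z //=; apply: qle_trans. Qed.
Definition qsum : qposet (A + B)%type := mk_qposet qsum_refl qsum_trans.
Lemma qsumE x y : qsum x y = r x y.
Proof. exact: mk_qposetE. Qed.
End DisjointUnion.

Variable A : finType.
Implicit Types P E : qposet A.

Definition qeqv P : rel A := [rel x y | P x y && P y x].

Definition is_discrete P : bool := [forall x, forall y, P x y == qeqv P x y].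

(* An equivalence relation on A is a symmetric quasi-poset on A. *)
Definition is_equiv E : bool := [forall x, forall y, E x y == E y x].

Definition qclass E (x : A) : {set A} := [set y | E x y].

Section Cut.
Variables P E : qposet A.
Let r := [rel x y | P x y && E x y].
Fact qcut_refl : reflexive r. Proof. by move=> x /=; rewrite !qle_refl. Qed.
Fact qcut_trans : transitive r.
Proof.
move=> y x z /andP[Pxy Exy] /andP[Pyz Eyz].
by rewrite /= (qle_trans Pxy Pyz) (qle_trans Exy Eyz).
Qed.
(* P|~ for the equivalence relation ~ = E *)
Definition qcut : qposet A := mk_qposet qcut_refl qcut_trans.
Lemma qcutE x y : qcut x y = P x y && E x y.
Proof. exact: mk_qposetE. Qed.
End Cut.

Section Quotient.
Variables P E : qposet A.
Let r := [rel x y | P x y || E x y].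
Fact qquo_refl : reflexive (connect r). Proof. by move=> x; apply: connect0. Qed.
Fact qquo_trans : transitive (connect r).
Proof. by move=> y x z; apply: connect_trans. Qed.
(* P/~ for ~ = E, still carried by A; as r is reflexive, its reflexive transitive
   closure [connect r] is its transitive closure. *)
Definition qquo : qposet A := mk_qposet qquo_refl qquo_trans.
Lemma qquoE x y : qquo x y = connect r x y.
Proof. exact: mk_qposetE. Qed.
End Quotient.

End Constructions.

Definition is_open (A : finType) (P : qposet A) (O : {set A}) : bool :=
  [forall i, forall j, (i \in O) && P i j ==> (j \in O)].

(* Nonemptiness is required so that the empty quasi-poset has no connected
   component. *)
Definition qconnected (A : finType) (P : qposet A) : bool :=
  (0 < #|A|)%N &&
  [forall O : {set A},
     is_open P O && is_open P (~: O) ==> (O == set0) || (O == setT)].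

(* The topology of [qrestr P C] is the subspace topology on C. *)
Definition qcomponents (A : finType) (P : qposet A) : {set {set A}} :=
  [set C | maxset (fun B => qconnected (qrestr P B)) C].

Definition cc (A : finType) (P : qposet A) : nat := #|qcomponents P|.

(* ~ <| P for ~ = E *)
Definition qtri (A : finType) (E P : qposet A) : bool :=
  [&& is_equiv E,
      [forall x, qconnected (qrestr P (qclass E x))] &
      [forall x, forall y, qeqv (qquo P E) x y == E x y]].

Definition qclasses (A : finType) (P : qposet A) : {set {set A}} :=
  equivalence_partition (qeqv P) [set: A].

Definition cl (A : finType) (P : qposet A) : nat := #|qclasses P|.

Section QuotientPoset.
Variables (A : finType) (P : qposet A).

Definition qbar_carrier : finType := {C : {set A} | C \in qclasses P}.

Let r (C D : qbar_carrier) : bool :=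
  [exists x in val C, exists y in val D, P x y].

Fact qbar_refl : reflexive r.
Proof.
case=> C CP; have /imsetP[x _ defC] := CP; have Cx : x \in C.
  by rewrite defC !inE /= /qeqv /= qle_refl.
by apply/exists_inP; exists x => //=; apply/exists_inP; exists x; rewrite ?qle_refl.
Qed.

Fact qbar_trans : transitive r.
Proof.
move=> D C E /exists_inP[x Cx /exists_inP[y Dy xy]].
case/exists_inP=> [y' Dy' /exists_inP[z Ez y'z]].
apply/exists_inP; exists x => //; apply/exists_inP; exists z => //.
apply: qle_trans xy (qle_trans _ y'z).
case/imsetP: (valP D) Dy Dy' => u _ -> /=; rewrite !inE /= => /andP[_ yu] /andP[uy' _].
exact: qle_trans yu uy'.
Qed.

Definition qbar : qposet qbar_carrier := mk_qposet qbar_refl qbar_trans.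

End QuotientPoset.

Definition bijb (A B : finType) (f : {ffun A -> B}) : bool :=
  injectiveb f && [forall y, y \in codom f].

(* Here and below, {1, ..., n} is replaced by the order-isomorphic 'I_n. *)
Definition heap_orderings (A : finType) (P : qposet A) :
    {set {ffun qbar_carrier P -> 'I_(cl P)}} :=
  [set f : {ffun qbar_carrier P -> 'I_(cl P)} | bijb f &&
     [forall x, forall y, qbar P x y ==> (f x <= f y)%N]].

Definition mu (A : finType) (P : qposet A) : nat := #|heap_orderings P|.

Definition Lmaps (A : finType) (P : qposet A) (k : nat) :
    {set {ffun A -> 'I_k}} :=
  [set f : {ffun A -> 'I_k} | [forall i, forall j, P i j ==> (f i <= f j)%N]].

Definition Lstrmaps (A : finType) (P : qposet A) (k : nat) :
    {set {ffun A -> 'I_k}} :=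
  [set f : {ffun A -> 'I_k} in Lmaps P k |
     [forall i, forall j, P i j && (f i == f j) ==> qeqv P i j]].

Definition qiso (A B : finType) (P : qposet A) (Q : qposet B) : bool :=
  [exists f : {ffun A -> B},
     bijb f && [forall x, forall y, P x y == Q (f x) (f y)]].

Section IsoTheory.

Lemma qisoP (A B : finType) (P : qposet A) (Q : qposet B) :
  reflect (exists2 f : A -> B, bijective f & P = qpull f Q) (qiso P Q).
Proof.
apply: (iffP existsP) => [[f /andP[/andP[/injectiveP fI /forallP fS]]]|[f fB ->]].
  move=> /'forall_forallP fM; exists f.
    pose g y := iinv (fS y).
    by exists g => [x|y]; [apply: fI|]; rewrite /g f_iinv.
  by apply: qposetP => x y; rewrite qpullE (eqP (fM x y)).
exists [ffun x => f x]; rewrite -andbA; apply/and3P; split.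
- by apply/injectiveP => x y; rewrite !ffunE; apply: bij_inj.
- case: fB => g _ fK; apply/forallP => y; apply/codomP; exists (g y).
  by rewrite ffunE fK.
- by apply/'forall_forallP => x y; rewrite !ffunE qpullE.
Qed.

Lemma qiso_pull (A B : finType) (f : A -> B) (Q : qposet B) :
  bijective f -> qiso (qpull f Q) Q.
Proof. by move=> fB; apply/qisoP; exists f. Qed.

Lemma qiso_refl (A : finType) (P : qposet A) : qiso P P.
Proof.
apply/qisoP; exists id; first exact: (Bijective (g := id)).
by apply: qposetP => x y; rewrite qpullE.
Qed.

Lemma qiso_sym (A B : finType) (P : qposet A) (Q : qposet B) :
  qiso P Q = qiso Q P.
Proof.
suff imp (A' B' : finType) (P' : qposet A') (Q' : qposet B') :
  qiso P' Q' -> qiso Q' P' by apply/idP/idP; apply: imp.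
case/qisoP=> f [g fK gK] ->; apply/qisoP; exists g; first exact: (Bijective gK fK).
by apply: qposetP => x y; rewrite !qpullE !gK.
Qed.

Lemma qiso_trans (A B C : finType) (P : qposet A) (Q : qposet B) (R : qposet C) :
  qiso P Q -> qiso Q R -> qiso P R.
Proof.
case/qisoP=> f fB -> /qisoP[g gB ->]; apply/qisoP; exists (g \o f).
  exact: bij_comp.
by apply: qposetP => x y; rewrite !qpullE.
Qed.

Lemma qiso_card (A B : finType) (P : qposet A) (Q : qposet B) :
  qiso P Q -> #|A| = #|B|.
Proof. by case/qisoP=> f fB _; apply: bij_eq_card fB. Qed.

Lemma qiso_sum (A B A' B' : finType) (P : qposet A) (Q : qposet B)
    (P' : qposet A') (Q' : qposet B') :
  qiso P P' -> qiso Q Q' -> qiso (qsum P Q) (qsum P' Q').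
Proof.
case/qisoP=> f [f' fK f'K] -> /qisoP[g [g' gK g'K] ->].
pose h (x : A + B) : A' + B' := match x with inl a => inl (f a) | inr b => inr (g b) end.
pose h' (x : A' + B') : A + B := match x with inl a => inl (f' a) | inr b => inr (g' b) end.
apply/qisoP; exists h.
  by exists h' => -[x|x] /=; rewrite ?fK ?gK ?f'K ?g'K.
by apply: qposetP => -[x|x] [y|y]; rewrite qpullE !qsumE //= qpullE.
Qed.

Lemma qiso_sumA (A B C : finType) (P : qposet A) (Q : qposet B) (R : qposet C) :
  qiso (qsum P (qsum Q R)) (qsum (qsum P Q) R).
Proof.
pose h (x : A + (B + C)) : (A + B) + C :=
  match x with inl a => inl (inl a) | inr (inl b) => inl (inr b) | inr (inr c) => inr c end.
pose h' (x : (A + B) + C) : A + (B + C) :=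
  match x with inl (inl a) => inl a | inl (inr b) => inr (inl b) | inr c => inr (inr c) end.
apply/qisoP; exists h; first by exists h'; [case=> [|[]]|case=> [[]|]].
by apply: qposetP => -[x|[x|x]] [y|[y|y]]; rewrite qpullE !qsumE //= qsumE.
Qed.

Lemma qiso_sumC (A B : finType) (P : qposet A) (Q : qposet B) :
  qiso (qsum P Q) (qsum Q P).
Proof.
pose h (A B : finType) (x : A + B) : B + A :=
  match x with inl a => inr a | inr b => inl b end.
apply/qisoP; exists (h A B); first by exists (h B A); case.
by apply: qposetP => -[x|x] [y|y]; rewrite qpullE !qsumE.
Qed.

Lemma qiso_sum0 (A B : finType) (P : qposet A) (Q : qposet B) :
  #|B| = 0%N -> qiso P (qsum P Q).
Proof.
move=> B0; have noB (b : B) : False by have := fintype0 b; rewrite B0; apply.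
apply/qisoP; exists inl; last by apply: qposetP => x y; rewrite qpullE qsumE.
pose h (x : A + B) : A :=
  match x with inl a => a | inr b => False_rect _ (noB b) end.
by exists h => // -[x|b] //; case: (noB b).
Qed.

End IsoTheory.

(* Every quasi-poset is isomorphic to one on some 'I_n. *)
Definition qcode : Type := {n : nat & qposet 'I_n}.
HB.instance Definition _ := Choice.on qcode.

Definition qcode_iso (c d : qcode) : bool := qiso (tagged c) (tagged d).

Lemma qcode_iso_equiv : equiv_class_of qcode_iso.
Proof.
split=> [c|c d|d c e]; first exact: qiso_refl.
  exact: qiso_sym.
exact: qiso_trans.
Qed.

Canonical qcode_iso_rel := EquivRelPack qcode_iso_equiv.

Definition isoclasses := {eq_quot qcode_iso_rel}.
HB.instance Definition _ := Choice.on isoclasses.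
HB.instance Definition _ := EqQuotient.on isoclasses.

Definition isoclass (A : finType) (P : qposet A) : isoclasses :=
  \pi_isoclasses (Tagged (fun n => qposet 'I_n) (qpull (@enum_val A A) P) : qcode).

Definition rep (a : isoclasses) : qposet 'I_(tag (repr a)) := tagged (repr a).

Lemma isoclassP (A B : finType) (P : qposet A) (Q : qposet B) :
  reflect (isoclass P = isoclass Q) (qiso P Q).
Proof.
have ePQ (C : finType) (R : qposet C) : qiso (qpull (@enum_val C C) R) R.
  by apply: qiso_pull; apply: enum_val_bij.
have eQP (C : finType) (R : qposet C) : qiso R (qpull (@enum_val C C) R).
  by rewrite qiso_sym.
apply: (iffP idP) => [PQ|/eqmodP PQ].
  by apply/eqmodP; exact: (qiso_trans (ePQ _ P) (qiso_trans PQ (eQP _ Q))).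
have {}PQ : qiso (qpull (@enum_val A A) P) (qpull (@enum_val B B) Q) by exact: PQ.
exact: qiso_trans (eQP _ P) (qiso_trans PQ (ePQ _ Q)).
Qed.

Lemma isoclass_rep a : isoclass (rep a) = a.
Proof.
rewrite -[RHS]reprK; apply/eqmodP; apply: qiso_pull.
exact: enum_val_bij.
Qed.

Lemma rep_isoclass (A : finType) (P : qposet A) : qiso (rep (isoclass P)) P.
Proof. by apply/isoclassP; rewrite isoclass_rep. Qed.

Definition iso_mul (a b : isoclasses) : isoclasses :=
  isoclass (qsum (rep a) (rep b)).

Fact qempty_refl : reflexive (fun _ _ : void => true). Proof. by []. Qed.
Fact qempty_trans : transitive (fun _ _ : void => true). Proof. by []. Qed.
Definition qempty : qposet void := mk_qposet qempty_refl qempty_trans.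

Definition iso_one : isoclasses := isoclass qempty.

Lemma iso_mulE (A B : finType) (P : qposet A) (Q : qposet B) :
  iso_mul (isoclass P) (isoclass Q) = isoclass (qsum P Q).
Proof. by apply/isoclassP/qiso_sum; apply: rep_isoclass. Qed.

Fact iso_mulA : associative iso_mul.
Proof.
move=> a b c; rewrite -[a]isoclass_rep -[b]isoclass_rep -[c]isoclass_rep.
by rewrite !iso_mulE; apply/isoclassP/qiso_sumA.
Qed.

Fact iso_mulC : commutative iso_mul.
Proof. by move=> a b; apply/isoclassP/qiso_sumC. Qed.

Fact iso_mulm1 : right_id iso_one iso_mul.
Proof.
move=> a; rewrite -[a]isoclass_rep iso_mulE; apply/esym/isoclassP/qiso_sum0.
exact: card_void.
Qed.

Fact iso_mul1m : left_id iso_one iso_mul.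
Proof. by move=> a; rewrite iso_mulC iso_mulm1. Qed.

Fact iso_unitm a b : iso_mul a b = iso_one -> a = iso_one /\ b = iso_one.
Proof.
move=> /isoclassP/qiso_card; rewrite card_sum card_void => /eqP.
rewrite addn_eq0 => /andP[/eqP a0 /eqP b0].
rewrite -[a]isoclass_rep -[b]isoclass_rep.
have empty n (P : qposet 'I_n) : #|'I_n| = 0%N -> isoclass P = iso_one.
  move=> n0; apply/isoclassP; have PP := qiso_sum0 P qempty card_void.
  apply: qiso_trans PP (qiso_trans (qiso_sumC _ _) _).
  by rewrite qiso_sym; apply: qiso_sum0.
by split; apply: empty.
Qed.

HB.instance Definition _ := Choice_isMonomialDef.Build isoclasses
  iso_mulA iso_mul1m iso_mulm1 iso_unitm.
HB.instance Definition _ := MonomialDef_isConomialDef.Build isoclasses iso_mulC.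
Section Transport.
Variables (A B : finType) (f : A -> B).
Hypothesis f_bij : bijective f.
Implicit Types P E : qposet B.

Lemma qiso_restr P (C : {set B}) :
  qiso (qrestr (qpull f P) (f @^-1: C)) (qrestr P C).
Proof.
have fC (x : {x | x \in f @^-1: C}) : f (val x) \in C.
  by have := valP x; rewrite inE.
pose h x : {y | y \in C} := Sub (f (val x)) (fC x).
apply/qisoP; exists h; last by apply: qposetP => x y; rewrite !qpullE.
apply: inj_card_bij => [x y /(congr1 val) /= fxy|].
  by apply: val_inj; apply: bij_inj fxy.
rewrite !card_sig on_card_preimset //; case: f_bij => g fK gK.
by exists g => x _; [apply: fK|apply: gK].
Qed.

Lemma is_open_pull P (C : {set B}) :
  is_open (qpull f P) (f @^-1: C) = is_open P C.
Proof.
case: f_bij => g fK gK; apply/'forall_forallP/'forall_forallP => Co x y.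
  by have := Co (g x) (g y); rewrite qpullE !inE !gK.
by rewrite qpullE !inE.
Qed.

Lemma preimset_bij : bijective (fun C : {set B} => f @^-1: C).
Proof.
case: f_bij => g fK gK; exists (fun C : {set A} => g @^-1: C) => C.
  by apply/setP => x; rewrite !inE gK.
by apply/setP => x; rewrite !inE fK.
Qed.

Lemma qpull_bij : bijective (fun E : qposet B => qpull f E).
Proof.
case: f_bij => g fK gK; exists (fun E : qposet A => qpull g E) => E.
  by apply: qposetP => x y; rewrite !qpullE !gK.
by apply: qposetP => x y; rewrite !qpullE !fK.
Qed.

Lemma qcut_pull P E : qcut (qpull f P) (qpull f E) = qpull f (qcut P E).
Proof. by apply: qposetP => x y; rewrite qcutE !qpullE qcutE. Qed.

Lemma qquo_pull P E : qquo (qpull f P) (qpull f E) = qpull f (qquo P E).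
Proof.
have homo_connect (C D : finType) (h : C -> D) (r : rel C) (s : rel D) :
    (forall x y, r x y -> s (h x) (h y)) ->
    forall x y, connect r x y -> connect s (h x) (h y).
  move=> rs x y /connectP[p]; elim: p x => [|z p IHp] x /= => [_ ->|/andP[xz zp] yE].
    exact: connect0.
  exact: connect_trans (connect1 (rs _ _ xz)) (IHp _ zp yE).
case: f_bij => g fK gK; apply: qposetP => x y; rewrite qpullE !qquoE.
apply/idP/idP => [|].
  by apply: homo_connect => {}x {}y /=; rewrite !qpullE.
rewrite -{2}[x]fK -{2}[y]fK.
by apply: homo_connect => {}x {}y /=; rewrite !qpullE !gK.
Qed.

End Transport.

Lemma qconnected_iso (A B : finType) (P : qposet A) (Q : qposet B) :
  qiso P Q -> qconnected P = qconnected Q.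
Proof.
case/qisoP=> f fB ->; rewrite /qconnected (bij_eq_card fB); congr (_ && _).
have [G KG KG'] := preimset_bij fB.
have p0 (C : {set B}) : (f @^-1: C == set0) = (C == set0).
  by rewrite -[in RHS](inj_eq (can_inj KG)); congr (_ == _); apply/setP => x; rewrite !inE.
have pT (C : {set B}) : (f @^-1: C == setT) = (C == setT).
  by rewrite -[in RHS](inj_eq (can_inj KG)); congr (_ == _); apply/setP => x; rewrite !inE.
apply/forallP/forallP => H C.
  by have := H (f @^-1: C); rewrite -preimsetC !(is_open_pull fB) p0 pT.
by rewrite -(KG' C) -preimsetC !(is_open_pull fB) p0 pT.
Qed.

Lemma cl_iso (A B : finType) (P : qposet A) (Q : qposet B) :
  qiso P Q -> cl P = cl Q.
Proof.
case/qisoP=> f fB ->; have [g fK gK] := fB.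
rewrite /cl -(card_imset (mem (qclasses Q)) (bij_inj (preimset_bij fB))); apply: eq_card => C.
have clE x : [set y in setT | qeqv (qpull f Q) x y] =
             f @^-1: [set y in setT | qeqv Q (f x) y].
  by apply/setP => y; rewrite !inE /qeqv /= !qpullE.
apply/imsetP/imsetP => [[x _ ->]|[D /imsetP[y _ ->] ->]].
  by exists [set y in setT | qeqv Q (f x) y]; rewrite ?clE ?imset_f.
by exists (g y); rewrite ?clE ?gK.
Qed.

Lemma qtri_pull (A B : finType) (f : A -> B) (E P : qposet B) :
  bijective f -> qtri (qpull f E) (qpull f P) = qtri E P.
Proof.
move=> fB; have [g fK gK] := fB; congr [&& _, _ & _].
- apply/'forall_forallP/'forall_forallP => H x y; last by rewrite !qpullE.
  by have := H (g x) (g y); rewrite !qpullE !gK.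
- have clE x : qclass (qpull f E) x = f @^-1: qclass E (f x).
    by apply/setP => y; rewrite !inE qpullE.
  apply/forallP/forallP => H x.
    by have := H (g x); rewrite clE (qconnected_iso (qiso_restr fB _ _)) gK.
  by rewrite clE (qconnected_iso (qiso_restr fB _ _)).
rewrite (qquo_pull fB); apply/'forall_forallP/'forall_forallP => H x y.
  by have := H (g x) (g y); rewrite /qeqv /= !qpullE !gK.
by rewrite /qeqv /= !qpullE; apply: H.
Qed.

Section LinearExtension.
Variables (K : fieldType) (I : choiceType) (V : lmodType K) (F : I -> V).

Definition lext (h : {malg K[I]}) : V := \sum_(i <- msupp h) h@_i *: F i.

Lemma lextU i : lext << i >> = F i.
Proof. by rewrite /lext msuppU oner_eq0 big_seq_fset1 mcoeffUU scale1r. Qed.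

Lemma lextEw (d : {fset I}) h :
  (msupp h `<=` d)%fset -> lext h = \sum_(i <- d) h@_i *: F i.
Proof.
move=> hd; rewrite /lext (big_fset_incl _ hd) //= => i _ /mcoeff_outdom ->.
by rewrite scale0r.
Qed.

Fact lext_is_linear : linear lext.
Proof.
move=> c g h; pose d := (msupp g `|` msupp h)%fset.
have gd : (msupp g `<=` d)%fset by apply: fsubsetUl.
have hd : (msupp h `<=` d)%fset by apply: fsubsetUr.
have cd : (msupp (c *: g + h) `<=` d)%fset.
  by apply: fsubset_trans (msuppD_le _ _) (fsetSU _ (msuppZ_le _ _)).
rewrite (lextEw gd) (lextEw hd) (lextEw cd) scaler_sumr -big_split /=.
by apply: eq_bigr => i _; rewrite mcoeffD mcoeffZ scalerDl scalerA.
Qed.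

HB.instance Definition _ := GRing.isLinear.Build K {malg K[I]} V _ lext
  lext_is_linear.

End LinearExtension.

Section DoubleBialgebra.
Variable K : fieldType.

(* The algebra of the monoid of isoclasses: basis the isoclasses, product
   induced by disjoint union. *)
Definition Hqp := {malg K[isoclasses]}.

(* Hqp (x) Hqp, with basis element <<(a, b)>> standing for a (x) b *)
Definition Hqp2 := {malg K[(isoclasses * isoclasses)%type]}.

Definition qb (A : finType) (P : qposet A) : Hqp := << isoclass P >>.

Definition qb2 (A B : finType) (P : qposet A) (Q : qposet B) : Hqp2 :=
  << (isoclass P, isoclass Q) >>.

Definition Delta_qposet (A : finType) (P : qposet A) : Hqp2 :=
  \sum_(O : {set A} | is_open P O) qb2 (qrestr P (~: O)) (qrestr P O).

Definition delta_qposet (A : finType) (P : qposet A) : Hqp2 :=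
  \sum_(E : qposet A | qtri E P) qb2 (qquo P E) (qcut P E).

(* Independence of the chosen representatives is Delta_qb and delta_qb. *)
Definition Delta : Hqp -> Hqp2 := lext (fun a => Delta_qposet (rep a)).
Definition delta : Hqp -> Hqp2 := lext (fun a => delta_qposet (rep a)).

(* The counit of Delta: 1 on the empty quasi-poset, 0 on other isoclasses *)
Definition epsilon (h : Hqp) : K := h@_iso_one.

Definition epsilon' : Hqp -> K :=
  lext (V := K^o) (fun a => (is_discrete (rep a))%:R).

Lemma qb2_iso (A B A' B' : finType) (P : qposet A) (Q : qposet B)
    (P' : qposet A') (Q' : qposet B') :
  qiso P P' -> qiso Q Q' -> qb2 P Q = qb2 P' Q'.
Proof. by move=> /isoclassP PP' /isoclassP QQ'; rewrite /qb2 PP' QQ'. Qed.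

Lemma Delta_qb (A : finType) (P : qposet A) : Delta (qb P) = Delta_qposet P.
Proof.
rewrite /Delta lextU; case/qisoP: (rep_isoclass P) => f fB ->.
rewrite /Delta_qposet (reindex _ (onW_bij _ (preimset_bij fB))) /=.
apply: eq_big => [O|O _]; first exact: is_open_pull.
by apply: qb2_iso; rewrite -?preimsetC; apply: qiso_restr.
Qed.

Lemma delta_qb (A : finType) (P : qposet A) : delta (qb P) = delta_qposet P.
Proof.
rewrite /delta lextU; case/qisoP: (rep_isoclass P) => f fB ->.
rewrite /delta_qposet (reindex _ (onW_bij _ (qpull_bij fB))) /=.
apply: eq_big => [E|E _]; first exact: qtri_pull.
by apply: qb2_iso; rewrite ?(qquo_pull fB) ?qcut_pull; apply: qiso_pull.
Qed.

Lemma epsilon'_qb (A : finType) (P : qposet A) :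
  epsilon' (qb P) = (is_discrete P)%:R.
Proof.
rewrite /epsilon' lextU; congr ((_ : bool)%:R).
case/qisoP: (rep_isoclass P) => f [g fK gK] ->.
apply/'forall_forallP/'forall_forallP => H x y.
  by have := H (g x) (g y); rewrite /qeqv /= !qpullE !gK.
by have := H (f x) (f y); rewrite /qeqv /= !qpullE.
Qed.

(* The degree-n component: the span of the isoclasses with cl = n *)
Definition Hqp_deg (n : nat) : {pred Hqp} :=
  [pred h : Hqp | all (fun a => cl (rep a) == n) (msupp h)].

Lemma Hqp_deg_qb (A : finType) (P : qposet A) (n : nat) :
  (qb P \in Hqp_deg n) = (cl P == n).
Proof.
by rewrite inE msuppU1 (eq_all_r (s2 := [:: isoclass P])) /= => [|a];
  rewrite ?inE // andbT (cl_iso (rep_isoclass P)).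
Qed.

Definition homogeneous (phi : Hqp -> {poly K}) : Prop :=
  forall n h, h \in Hqp_deg n -> exists c, phi h = c *: 'X^n.

(* K[X] (x) K[X] is identified with {poly {poly K}}, p (x) q being
    p('Y) q('X); the coproduct of p is then p('X + 'Y) = [poly_XaY p]. *)
Definition tens_poly (phi psi : Hqp -> {poly K}) (t : Hqp2) : {poly {poly K}} :=
  \sum_(ab <- msupp t) (t@_ab *: phi << ab.1 >>) *: (psi << ab.2 >>)^:P.

(* An algebra morphism that is a coalgebra morphism; compatibility with the
   antipodes is then automatic. *)
Definition is_Hopf_morphism (phi : {lrmorphism Hqp -> {poly K}}) : Prop :=
  (forall h, poly_XaY (phi h) = tens_poly phi phi (Delta h)) /\
  (forall h, (phi h).[0] = epsilon h).

Definition is_phi0 (phi0 : {lrmorphism Hqp -> {poly K}}) : Prop :=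
  [/\ is_Hopf_morphism phi0, homogeneous phi0 &
      forall (A : finType) (P : qposet A), (0 < #|A|)%N ->
        (forall x y, P x y) -> phi0 (qb P) = 'X].

Definition character := {lrmorphism Hqp -> K | *%R}.

(* lambda * mu = (lambda (x) mu) o delta *)
Definition conv (lambda mu : Hqp -> K) (h : Hqp) : K :=
  lext (V := K^o) (fun ab => lambda << ab.1 >> * mu << ab.2 >>) (delta h).

(* phi <- lambda = (phi (x) lambda) o delta, with K[X] (x) K = K[X] *)
Definition leftact (phi : Hqp -> {poly K}) (lambda : Hqp -> K) (h : Hqp) : {poly K} :=
  lext (fun ab => lambda << ab.2 >> *: phi << ab.1 >>) (delta h).

Definition is_inverse (alpha beta : character) : Prop :=
  conv alpha beta =1 epsilon' /\ conv beta alpha =1 epsilon'.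

Definition is_ehr (ehr : {linear Hqp -> {poly K}}) : Prop :=
  forall (A : finType) (P : qposet A) (k : nat), (0 < k)%N ->
    (ehr (qb P)).[k%:R] = #|Lmaps P k|%:R.

Definition is_ehr_str (ehr_str : {linear Hqp -> {poly K}}) : Prop :=
  forall (A : finType) (P : qposet A) (k : nat), (0 < k)%N ->
    (ehr_str (qb P)).[k%:R] = #|Lstrmaps P k|%:R.

End DoubleBialgebra.

Arguments qb {K A} P.

(* Main.v *)
From HB Require Import structures.
Require Import Defs.
From mathcomp Require Import all_boot all_order all_algebra.

Set Implicit Arguments.
Unset Strict Implicit.
Unset Printing Implicit Defensive.

Import GRing.Theory.
Local Open Scope ring_scope.

(** The proof rests on three ideas.

    Reciprocity. A monotone map from [P] to a chain of [k] points is a chain of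
    [k + 1] nested open sets from the full set to the empty one, so the three
    kinds of maps at stake (monotone, strict, surjective) are counted by powers
    of operators on functions on open sets: [zeta], [zeta_discrete] and
    [zeta_strict = zeta - 1]. As [zeta - 1] is nilpotent, the identity between
    [ehr_P(k)] and [zeta^k] holds at all integers ([poly_unipotent]), and
    [zeta^-1], the Moebius operator of the lattice of open sets, is
    [zeta_discrete] up to signs ([zeta_moebius], by toggling a maximal class):
    this is the duality principle ([ehrhart_reciprocity]). The same identity
    gives the leading coefficient of [ehr_P], which counts surjections, that is,
    heap-orderings ([ehrhart_lead_coef], [mu_surjections]).

    Reading coefficients. In the expansion of [ehr_P] given by
    [ehr = phi_0 <- alpha], the equivalence [~] contributes to the degree [cl(~)].
    When [P] is connected only the total equivalence has one class, so the linear
    coefficient is [alpha_P]; by duality the one of [ehrstr_P] is the same up to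
    the sign [(-1)^(cl(P) + 1)], and everything being multiplicative the second
    assertion follows. Only [~_P] has [cl(P)] classes, so the leading coefficient
    is [lambda_P], whence [lambda_P = mu_P / cl(P)!].

    Inverting [alpha]. Let [beta_P = (-1)^(cl(P) + cc(P)) lambda_P]. Since
    [cc(P/~) = cc(P)] for admissible [~], [(beta * alpha)_P] is
    [(-1)^cc(P) ehr_P(-1)], which by duality is the number of strict maps from
    [P] to a point up to a sign, that is, [epsilon'_P] ([sign_twist_conv]).
    Convolution on the right by [alpha] is triangular with respect to [cl], hence
    injective ([qconv_injl]); with the associativity of the convolution
    ([qconvA], a modular law for quasi-posets) and
    [(alpha * beta) * alpha = alpha] it shows that the left inverse [beta] is the
    unique inverse. *)

(** * Finite differences of polynomials *)

Section FiniteDifferences.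
Variable K : fieldType.
Hypothesis K_char0 : [pchar K] =i pred0.
Implicit Types p q : {poly K}.

Lemma natr_eq0_char0 n : (n%:R == 0 :> K) = (n == 0)%N.
Proof. by move: n; apply/pcharf0P. Qed.

Lemma natr_inj_char0 : injective (fun n => n%:R : K).
Proof.
suff le_inj (m n : nat) : (m <= n)%N -> m%:R = n%:R :> K -> m = n.
  by move=> m n /= mn; case/orP: (leq_total m n) => /le_inj H; [|symmetry]; apply: H.
move=> le_mn /eqP; rewrite eq_sym -subr_eq0 -natrB // natr_eq0_char0 subn_eq0 => le_nm.
by apply/eqP; rewrite eqn_leq le_mn.
Qed.

Lemma poly_eq_nat p q m :
  (forall k, (m <= k)%N -> p.[k%:R] = q.[k%:R]) -> p = q.
Proof.
move=> pq; apply/eqP; rewrite -subr_eq0; apply/eqP.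
apply: (@roots_geq_poly_eq0 _ _ [seq k%:R | k <- iota m (size (p - q))]).
- apply/allP => _ /mapP[k /[!mem_iota]/andP[mk _] ->].
  by rewrite /root hornerD hornerN pq ?subrr.
- by rewrite map_inj_uniq ?iota_uniq //; apply: natr_inj_char0.
- by rewrite size_map size_iota.
Qed.

Definition fdiff p : {poly K} := p \Po ('X + 1) - p.

Lemma horner_fdiff p x : (fdiff p).[x] = p.[x + 1] - p.[x].
Proof. by rewrite hornerD hornerN horner_comp hornerD hornerX hornerC. Qed.

(** Among the monomials of [p], only the leading one survives in degree [n]: it
    gives [(n + 1) X^n] plus lower terms. *)
Lemma coef_fdiff p n m : (size p <= n.+2)%N -> (n <= m)%N ->
  (fdiff p)`_m = p`_n.+1 *+ (n.+1 * (m == n)).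
Proof.
move=> ps nm; have Xcoef i : (('X + 1 : {poly K}) ^+ i)`_m = 'C(i, m)%:R.
  rewrite exprD1n coef_sum (eq_bigr (fun j : 'I__ => (m == j)%:R *+ 'C(i, j))).
    case: (ltnP m i.+1) => [mi|im].
      rewrite (bigD1 (Ordinal mi)) //= eqxx big1 ?addr0 // => j /eqP jm.
      by case: eqP => [mj|]; [case: jm; apply: val_inj|rewrite mul0rn].
    rewrite bin_small // big1 // => j _; case: eqP => [mj|]; last by rewrite mul0rn.
    by move: im; rewrite mj ltnNge -ltnS ltn_ord.
  by move=> j _; rewrite coefMn coefXn.
rewrite coefB coef_comp_poly.
rewrite (big_ord_widen _ (fun i => p`_i * (('X + 1) ^+ i)`_m) ps) big_mkcond /=.
rewrite (eq_bigr (fun i : 'I__ => p`_i * 'C(i, m)%:R)); last first.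
  by move=> i _; rewrite Xcoef; case: ltnP => // /(nth_default 0) ->; rewrite mul0r.
rewrite !big_ord_recr /= big1 ?add0r; last first.
  by move=> i _; rewrite bin_small ?mulr0 // (leq_trans (ltn_ord i)).
case: (ltngtP n m) nm => // [nm|<-] _; last first.
  by rewrite binn mulr1 addrAC subrr add0r binSn /= muln1 mulr_natr.
rewrite (bin_small nm) mulr0 add0r muln0 mulr0n.
case: (ltngtP n.+1 m) nm => // [nm|<-] _; last by rewrite binn mulr1 subrr.
by rewrite bin_small // mulr0 nth_default ?subrr // (leq_trans ps).
Qed.

Lemma iter_fdiff n p : (size p <= n.+1)%N ->
  iter n fdiff p = (p`_n *+ n`!)%:P.
Proof.
elim: n p => [|n IHn] p ps; first by rewrite mulr1n -size1_polyC.
rewrite iterSr IHn; last first.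
  apply/leq_sizeP => m nm; rewrite (coef_fdiff ps (ltnW nm)).
  by rewrite gtn_eqF // muln0.
by rewrite (coef_fdiff ps) // eqxx muln1 factS mulrnA.
Qed.

(** Newton's view of polynomials: when a power of [N] kills [u], the sequence
    [k |-> (1 + N)^k u] is polynomial in [k]. *)
Section UnipotentIterates.
Variables (U : zmodType) (N Z : U -> U) (l : {additive U -> K}).
Hypotheses (ND : {morph N : u v / u + v}) (ZE : forall u, Z u = u + N u).

Lemma unipotent_iterS u k : iter k.+1 Z u - iter k Z u = iter k Z (N u).
Proof.
rewrite iterS ZE addrC addKr; elim: k => //= k <-.
by rewrite !ZE ND.
Qed.

Lemma poly_iter_fdiff u p :
  (forall k, p.[k%:R] = l (iter k Z u)) ->
  forall n k, (iter n fdiff p).[k%:R] = l (iter k Z (iter n N u)).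
Proof.
move=> pu; elim=> [|n IHn] k //=.
by rewrite horner_fdiff natr1 !IHn -unipotent_iterS raddfB.
Qed.

(** Both sequences are determined by their large terms. The induction is on the
    power of [N] that kills [u]: differencing replaces [u] by [N u], and equality
    of the differences propagates equality of the values downwards. *)
Lemma poly_unipotent u p n m : iter n N u = 0 ->
  (forall k, (m <= k)%N -> p.[k%:R] = l (iter k Z u)) ->
  forall k, p.[k%:R] = l (iter k Z u).
Proof.
elim: n u p => [|n IHn] u p Nu pu k.
  have Z0 j : iter j Z u = 0.
    rewrite (Nu : u = 0); elim: j => //= j ->; rewrite ZE add0r.
    by apply: (addrI (N 0)); rewrite -ND !addr0.
  suff -> : p = 0 by rewrite Z0 raddf0 horner0.
  by apply: (@poly_eq_nat _ _ m) => j mj; rewrite pu // Z0 raddf0 horner0.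
have step j : p.[j.+1%:R] - p.[j%:R] = l (iter j.+1 Z u) - l (iter j Z u).
  rewrite -raddfB unipotent_iterS -natr1 -horner_fdiff; apply: IHn.
    by rewrite -iterSr.
  move=> {}k mk; rewrite horner_fdiff -unipotent_iterS raddfB natr1.
  by rewrite !pu // ltnW.
have [i] := ubnP (m - k); elim: i k => // i IHi k; rewrite ltnS => ki.
case: (leqP m k) => [|km]; first exact: pu.
have := step k; rewrite IHi; last first.
  by rewrite subnS prednK ?subn_gt0.
by move/addrI/oppr_inj.
Qed.

End UnipotentIterates.
End FiniteDifferences.

(** * Monotone maps as chains of open sets *)

Section OpenChains.
Variables (A : finType) (P : qposet A).
Implicit Types (U V W B : {set A}) (c : pred {set A}).

Lemma openP U : reflect (forall x y, x \in U -> P x y -> y \in U) (is_open P U).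
Proof.
apply: (iffP 'forall_forallP) => UO x y; last by apply/implyP => /andP[]; apply: UO.
by move=> xU xy; move/implyP: (UO x y); apply; rewrite xU.
Qed.

Definition opens : finType := {U : {set A} | is_open P U}.

Lemma open0 : is_open P set0.
Proof. by apply/openP => x y; rewrite inE. Qed.

Lemma openT : is_open P setT.
Proof. by apply/openP => x y; rewrite inE. Qed.

Definition opens0 : opens := Sub set0 open0.
Definition opensT : opens := Sub setT openT.

Definition qdiscrete_on : pred {set A} :=
  fun B => [forall x in B, forall y in B, P x y ==> P y x].

Lemma qdiscrete_onP B :
  reflect {in B &, forall x y, P x y -> P y x} (qdiscrete_on B).
Proof.
apply: (iffP forall_inP) => [H x y xB yB|H x xB].
  by move/forall_inP: (H x xB) => /(_ y yB)/implyP.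
by apply/forall_inP => y yB; apply/implyP; apply: H.
Qed.

(** Value [0] marks the complement of [V], so that maps defined on an open set
    need no subtype. *)
Definition layerings c k V : {set {ffun A -> 'I_k.+1}} :=
  [set f : {ffun A -> 'I_k.+1} |
    [&& [forall x, forall y, P x y ==> (f x <= f y)%N],
        [forall x, (x \in V) == (0 < f x)%N] &
        [forall i : 'I_k.+1, (0 < i)%N ==> c [set x | f x == i]]]].

Lemma layeringsP c k V (f : {ffun A -> 'I_k.+1}) :
  reflect [/\ forall x y, P x y -> (f x <= f y)%N,
              forall x, (x \in V) = (0 < f x)%N &
              forall i : 'I_k.+1, (0 < i)%N -> c [set x | f x == i]]
          (f \in layerings c k V).
Proof.
rewrite inE; apply: (iffP and3P) => [[/'forall_forallP H1 /forallP H2 /forallP H3]|].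
  split=> [x y|x|i]; [by apply/implyP|exact/eqP|by apply/implyP].
case=> H1 H2 H3; split; first by apply/'forall_forallP => x y; apply/implyP/H1.
  by apply/forallP => x; apply/eqP.
by apply/forallP => i; apply/implyP/H3.
Qed.

Lemma card_layerings0 c V : #|layerings c 0 V| = (V == set0).
Proof.
have -> : layerings c 0 V = if V == set0 then setT else set0.
  apply/setP => f; have f0 x : f x = ord0 by rewrite ord1.
  apply/layeringsP/idP => [[_ H _]|].
    case: eqP => [|[]]; first by rewrite inE.
    by apply/setP => x; rewrite H f0 inE.
  case: eqP => [-> _|]; last by rewrite inE.
  by split=> [x y|x|i]; rewrite ?f0 ?inE // ord1.
by case: eqP; rewrite ?cards0 // cardsT card_ffun card_ord exp1n.
Qed.

(** The set [U] where a layering takes values above [1] determines its first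
    layer [V :\: U]; what is left is a layering of [U], shifted by one. *)
Lemma card_layeringsS c k (V : opens) :
  #|layerings c k.+1 (val V)| =
  (\sum_(U : opens | (val U \subset val V) && c (val V :\: val U))
     #|layerings c k (val U)|)%N.
Proof.
pose top (f : {ffun A -> 'I_k.+2}) : opens := insubd opens0 [set x | (1 < f x)%N].
have topE f : f \in layerings c k.+1 (val V) ->
    val (top f) = [set x | (1 < f x)%N].
  case/layeringsP=> H1 _ _; apply: insubdK; apply/openP => x y.
  by rewrite !inE => x1 /H1; apply: leq_trans.
pose below (U : opens) := (val U \subset val V) && c (val V :\: val U).
rewrite -sum1_card (partition_big top below) => [|f fL]; last first.
  have [H1 H2 H3] := layeringsP _ _ _ fL; apply/andP; split.
    by rewrite topE //; apply/subsetP => x; rewrite inE H2; apply: ltnW.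
  have -> : val V :\: val (top f) = [set x | f x == inord 1]; last by apply: H3; rewrite inordK.
  apply/setP => x; rewrite topE // !inE H2 -(inj_eq val_inj) /= inordK //.
  by case: (nat_of_ord (f x)) => [|[]].
apply: eq_bigr => U /andP[UV cVU]; rewrite sum1_card.
pose raise (g : {ffun A -> 'I_k.+1}) : {ffun A -> 'I_k.+2} :=
  [ffun x => inord (if x \in val V then (g x).+1 else 0)%N].
have raiseE g x : raise g x = (if x \in val V then (g x).+1 else 0)%N :> nat.
  by rewrite ffunE inordK //; case: ifP => // _; exact: (ltn_ord (g x)).
have raise_inj : {in layerings c k (val U) &, injective raise}.
  move=> g h /layeringsP[_ gU _] /layeringsP[_ hU _] /ffunP gh; apply/ffunP => x.
  apply: val_inj; have := congr1 val (gh x); rewrite /= !raiseE.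
  case: ifP => [_ []//|/negbT xV _]; have := contraNN (subsetP UV x) xV.
  move=> xU; have := gU x; have := hU x; rewrite (negbTE xU).
  by case: (nat_of_ord (g x)) => [|]; case: (nat_of_ord (h x)).
rewrite -(card_in_imset raise_inj); apply: eq_card => f.
apply/andP/imsetP => [[fL /eqP defU]|[g gL ->]].
  have [H1 H2 H3] := layeringsP _ _ _ fL.
  have fU x : (x \in val U) = (1 < f x)%N by rewrite -defU topE // inE.
  have fle x : ((f x).-1 < k.+1)%N by rewrite ltnS -subn1 leq_subLR add1n -ltnS ltn_ord.
  pose g : {ffun A -> 'I_k.+1} := [ffun x => inord (f x).-1].
  have gE x : g x = (f x).-1 :> nat by rewrite ffunE inordK.
  exists g; last first.
    apply/ffunP => x; apply: val_inj; rewrite /= raiseE gE H2.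
    by case: (nat_of_ord (f x)).
  apply/layeringsP; split=> [x y /H1|x|i i0].
  - by rewrite !gE -!subn1; apply: leq_sub2r.
  - by rewrite gE fU; case: (nat_of_ord (f x)) => [|[]].
  have -> : [set x | g x == i] = [set x | f x == lift ord0 i]; last exact: H3.
  apply/setP => x; rewrite !inE -!(inj_eq val_inj) /= gE /bump /= add1n.
  by case: (nat_of_ord (f x)) => //=; case: (nat_of_ord i) i0.
have [H1 H2 H3] := layeringsP _ _ _ gL.
have /openP VO := valP V; have fL : raise g \in layerings c k.+1 (val V).
  apply/layeringsP; split=> [x y xy|x|i i0]; rewrite ?raiseE.
  - by case: ifP => // /VO/(_ xy) ->; rewrite ltnS H1.
  - by case: ifP.
  have [i1|i1] := eqVneq (nat_of_ord i) 1%N.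
    have -> : [set x | raise g x == i] = val V :\: val U; last by [].
    apply/setP => x; rewrite !inE -(inj_eq val_inj) /= raiseE i1 H2.
    by case: ifP; rewrite ?andbF // andbT; case: (nat_of_ord (g x)).
  have i2 : (1 < i)%N by case: (nat_of_ord i) i0 i1 => [|[]].
  have ik : (i.-1 < k.+1)%N by rewrite ltnS -subn1 leq_subLR add1n -ltnS ltn_ord.
  have -> : [set x | raise g x == i] = [set x | g x == Ordinal ik]; last first.
    by apply: H3 => /=; case: (nat_of_ord i) i2 => [|[]].
  apply/setP => x; rewrite !inE -!(inj_eq val_inj) /= raiseE.
  case: ifP => [_|/negbT xV]; first by case: (nat_of_ord i) i0.
  have := H2 x; rewrite (contraNF (subsetP UV x) xV) => /esym/negbT.
  rewrite -leqNgt leqn0 => /eqP ->; rewrite eq_sym (gtn_eqF i0) eq_sym gtn_eqF //.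
  by case: (nat_of_ord i) i2 => [|[]].
split=> //; apply/eqP/val_inj; rewrite topE //; apply/setP => x.
rewrite inE raiseE H2; case: ifP => // /negbT xV.
by apply/esym/negbTE; rewrite -H2; apply: contraNN xV; apply: subsetP.
Qed.

Lemma card_layeringsT c k :
  #|layerings c k setT| =
  #|[set f in Lmaps P k | [forall i, c [set x | f x == i]]]|.
Proof.
pose raise (f : {ffun A -> 'I_k}) : {ffun A -> 'I_k.+1} := [ffun x => lift ord0 (f x)].
have raise_inj : injective raise.
  by move=> f g /ffunP fg; apply/ffunP => x; have := fg x; rewrite !ffunE => /lift_inj.
rewrite -(card_imset _ raise_inj); apply: eq_card => g.
have fibre f i : [set x | raise f x == lift ord0 i] = [set x | f x == i].
  by apply/setP => x; rewrite !inE ffunE (inj_eq lift_inj).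
apply/layeringsP/imsetP => [[H1 H2 H3]|[f /[!inE]/andP[/'forall_forallP H1 /forallP H2] ->]].
  have gx x : {i | g x = lift ord0 i}.
    case: (unliftP ord0 (g x)) => [i ->|gx0]; first by exists i.
    by have := H2 x; rewrite gx0 inE.
  have [f gE] : exists f, g = raise f.
    exists [ffun x => sval (gx x)]; apply/ffunP => x; rewrite !ffunE.
    by case: (gx x).
  rewrite gE {gx g gE} in H1 H2 H3 *; exists f; rewrite // !inE; apply/andP; split.
    apply/'forall_forallP => x y; apply/implyP => /H1.
    by rewrite !ffunE /= /bump /= !add1n ltnS.
  by apply/forallP => i; rewrite -fibre; apply: H3.
split=> [x y|x|i].
- by rewrite !ffunE /= /bump /= !add1n ltnS; apply/implyP/H1.
- by rewrite ffunE inE.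
by case: (unliftP ord0 i) => [j ->|-> //]; rewrite fibre.
Qed.

Section Operators.
Variable K : fieldType.
Implicit Types u : {ffun opens -> K}.

(** The power [k] of this operator sums over the chains of [k + 1] nested open
    sets whose successive differences satisfy [c]. *)
Definition chain_step c u : {ffun opens -> K} :=
  [ffun V : opens => \sum_(U : opens | (val U \subset val V) && c (val V :\: val U)) u U].

Definition at_empty : {ffun opens -> K} := [ffun V : opens => (V == opens0)%:R].

Lemma chain_stepD c : {morph chain_step c : u v / u + v}.
Proof.
move=> u v; apply/ffunP => V; rewrite !ffunE -big_split /=.
by apply: eq_bigr => U _; rewrite ffunE.
Qed.

Lemma iter_chain_step c k (V : opens) :
  iter k (chain_step c) at_empty V = #|layerings c k (val V)|%:R.
Proof.
elim: k V => [|k IHk] V; first by rewrite ffunE card_layerings0 -(inj_eq val_inj).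
by rewrite ffunE card_layeringsS natr_sum; apply: eq_bigr.
Qed.

Lemma iter_chain_stepT c k :
  iter k (chain_step c) at_empty opensT =
  #|[set f in Lmaps P k | [forall i, c [set x | f x == i]]]|%:R.
Proof. by rewrite iter_chain_step card_layeringsT. Qed.

(** The zeta operator of the lattice of open sets, and the two restrictions of
    it that count surjective and strict maps. *)
Definition zeta := chain_step predT.
Definition zeta_strict := chain_step (fun B => B != set0).
Definition zeta_discrete := chain_step qdiscrete_on.

Lemma zetaE u : zeta u = u + zeta_strict u.
Proof.
apply/ffunP => V; rewrite !ffunE (bigD1 V) /= ?subxx //; congr (_ + _).
apply: eq_bigl => U; rewrite andbT; case: (boolP (_ \subset _)) => //= UV.
by rewrite setD_eq0 -(inj_eq val_inj) eqEsubset UV.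
Qed.

Lemma zeta_strict_nilpotent u n : (#|A| < n)%N -> iter n zeta_strict u = 0.
Proof.
move=> An; suff H k (V : opens) : (#|val V| < k)%N -> iter k zeta_strict u V = 0.
  by apply/ffunP => V; rewrite H ?ffunE // (leq_ltn_trans (max_card _)).
elim: k V => // k IHk V Vk; rewrite ffunE big1 // => U /andP[UV].
rewrite setD_eq0 => VU; apply: IHk; rewrite -ltnS.
apply: leq_trans Vk; rewrite ltnS; by apply: proper_card; rewrite properE UV.
Qed.

End Operators.
End OpenChains.

(** * Reciprocity *)

Section Classes.
Variables (A : finType).
Implicit Types (P : qposet A) (x y : A).

Definition qcls P x : {set A} := [set y | qeqv P x y].

Lemma qeqv_refl P : reflexive (qeqv P).
Proof. by move=> x; rewrite /qeqv /= qle_refl. Qed.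

Lemma qeqv_sym P : symmetric (qeqv P).
Proof. by move=> x y; rewrite /qeqv /= andbC. Qed.

Lemma qeqv_trans P : transitive (qeqv P).
Proof.
move=> y x z /andP[xy yx] /andP[yz zy].
by rewrite /qeqv /= (qle_trans xy yz) (qle_trans zy yx).
Qed.

Lemma qcls_eq P x y : (qcls P x == qcls P y) = qeqv P x y.
Proof.
apply/eqP/idP => [/setP/(_ y)|xy]; first by rewrite !inE qeqv_refl.
apply/setP => z; rewrite !inE; apply/idP/idP; apply: qeqv_trans => //.
by rewrite qeqv_sym.
Qed.

Lemma qclassesE P : qclasses P = qcls P @: setT.
Proof.
by apply: eq_in_imset => x _; apply/setP => y; rewrite !inE.
Qed.

(** For a union [B] of classes this is [cl] of the restriction of [P] to [B],
    without a subtype. *)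
Definition ncls P (B : {set A}) : nat := #|qcls P @: B|.

Lemma cl_ncls P : cl P = ncls P setT.
Proof. by rewrite /cl qclassesE. Qed.

End Classes.

Section Moebius.
Variables (K : fieldType) (A : finType) (P : qposet A).
Hypothesis K_char0 : [pchar K] =i pred0.
Implicit Types (U : {set A}) (V W : opens P) (u : {ffun opens P -> K}).

Lemma open_qcls (U : {set A}) x y : is_open P U -> qeqv P x y -> (x \in U) = (y \in U).
Proof. by move/openP => UO /andP[xy yx]; apply/idP/idP => H; apply: UO H _. Qed.

Lemma exists_maximal (B : {set A}) : B != set0 ->
  exists2 x, x \in B & {in B, forall y, P x y -> P y x}.
Proof.
case/set0Pn=> x0 x0B.
case: (arg_minnP (fun x => #|[set y | P x y]|) x0B) => x xB xmin.
exists x => // y yB xy.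
have sub : [set z | P y z] \subset [set z | P x z].
  by apply/subsetP => z; rewrite !inE; apply: qle_trans.
have /eqP/setP/(_ x) : [set z | P y z] == [set z | P x z].
  by rewrite eqEcard sub xmin.
by rewrite !inE qle_refl.
Qed.

(** The sum that has to vanish for [zeta * moebius = 1] runs over the open sets
    [U] between [W] and [V] with [U :\: W] discrete. The class of a maximal [x] of
    [V :\: W] can be added to or removed from such a [U]. *)
Section Toggle.
Variables (W V : opens P) (x : A).
Hypotheses (xV : x \in val V) (xW : x \notin val W).
Hypothesis x_max : {in val V :\: val W, forall y, P x y -> P y x}.

Definition between (U : {set A}) :=
  [&& is_open P U, val W \subset U, U \subset val V & qdiscrete_on P (U :\: val W)].

Definition toggle_set (U : {set A}) :=
  if x \in U then U :\: qcls P x else U :|: qcls P x.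

Lemma toggle_setK U : is_open P U -> toggle_set (toggle_set U) = U.
Proof.
move=> UO; have sat y : y \in qcls P x -> (y \in U) = (x \in U).
  by rewrite inE => xy; rewrite -(open_qcls UO xy).
rewrite {2}/toggle_set; case: ifP => xU; rewrite /toggle_set !inE qeqv_refl /= ?orbT;
  apply/setP => y; rewrite !inE; have := sat y; rewrite inE xU;
  by case: (qeqv P x y) => [/(_ isT) ->|_]; rewrite ?andbF ?orbF ?orbT ?andbT.
Qed.

Lemma between_toggle U : between U -> between (toggle_set U).
Proof.
case/and4P=> UO WU UV /qdiscrete_onP Ud.
have /openP VO := valP V; have /openP WO := valP W; have /openP UO' := UO.
have CW y : qeqv P x y -> y \notin val W.
  by move/(open_qcls (valP W)) <-.
have CV y : qeqv P x y -> y \in val V.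
  by move/(open_qcls (valP V)) <-.
rewrite /toggle_set; case: ifP => xU; apply/and4P; split.
- apply/openP => y z; rewrite !inE => /andP[yC yU] yz; rewrite (UO' _ _ yU yz) andbT.
  apply: contra yC => xz; have := xz => /andP[_ zx]; apply/andP; split; last exact: qle_trans zx.
  apply: Ud; rewrite ?inE ?xW ?xU ?yU ?andbT //; last exact: qle_trans zx.
  apply: contra xW => yW; apply: WO yW _; exact: qle_trans zx.
- by apply/subsetP => y yW; rewrite !inE (subsetP WU) // andbT; apply: contraL yW; apply: CW.
- by apply: subset_trans UV; apply: subsetDl.
- apply/qdiscrete_onP => y z; rewrite !inE => /and3P[yW _ yU] /and3P[zW _ zU].
  by apply: Ud; rewrite inE ?yW ?zW.
- apply/openP => y z; rewrite !inE => /orP[yU yz|xy yz]; first by rewrite (UO' _ _ yU yz).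
  have xz : P x z by case/andP: xy => xy _; apply: qle_trans yz.
  case: (boolP (z \in val W)) => [/(subsetP WU) -> //|zW].
  by rewrite /qeqv /= xz x_max ?orbT // inE zW (VO _ _ xV xz).
- by apply: subset_trans WU _; apply: subsetUl.
- by rewrite subUset UV; apply/subsetP => y; rewrite inE; apply: CV.
apply/qdiscrete_onP => y z; rewrite !inE => /andP[yW /orP[yU|xy]] /andP[zW /orP[zU|xz]] yz.
- by apply: Ud yz; rewrite inE ?yW ?zW.
- by move: (UO' _ _ yU yz); rewrite -(open_qcls UO xz) xU.
- have zV := subsetP UV _ zU; case/andP: xy => xy yx.
  by apply: (qle_trans _ xy); apply: x_max (qle_trans xy yz); rewrite inE zW.
by have /andP[] := qeqv_trans (etrans (qeqv_sym P y x) xy) xz.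
Qed.

Lemma ncls_toggle U : between U ->
  (-1) ^+ ncls P (toggle_set U) = - (-1) ^+ ncls P U :> K.
Proof.
have add B : is_open P B -> x \notin B ->
    ncls P (B :|: qcls P x) = (ncls P B).+1.
  move=> BO xB; rewrite /ncls imsetU.
  have -> : qcls P @: qcls P x = [set qcls P x].
    apply/setP => C; rewrite inE; apply/imsetP/eqP => [[y]|->].
      by rewrite inE => xy ->; apply/eqP; rewrite qcls_eq qeqv_sym.
    by exists x; rewrite // inE qeqv_refl.
  rewrite setUC cardsU1; suff -> : qcls P x \notin qcls P @: B by [].
  apply/imsetP => -[y yB /eqP]; rewrite qcls_eq => /(open_qcls BO) E.
  by rewrite E yB in xB.
move=> bU; have /and4P[UO _ _ _] := bU.
have /and4P[tO _ _ _] := between_toggle bU.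
case: (boolP (x \in U)) => xU; last first.
  by rewrite /toggle_set (negbTE xU) add // exprS mulN1r.
have xt : x \notin toggle_set U by rewrite /toggle_set xU !inE qeqv_refl.
have := toggle_setK UO; rewrite {1}/toggle_set (negbTE xt) => {2}<-.
by rewrite add // exprS mulN1r opprK.
Qed.

(** Toggling the class of [x] is an involution that reverses the sign. *)
Lemma sum_between0 :
  \sum_(U : {set A} | between U) (-1) ^+ ncls P U = 0 :> K.
Proof.
set S := \sum_(U | _) _; suff : S = - S.
  move/eqP; rewrite -addr_eq0 -mulr2n -mulr_natr mulf_eq0.
  by rewrite (natr_eq0_char0 K_char0) orbF => /eqP.
rewrite {1}/S (reindex_onto toggle_set toggle_set) => [|U /and4P[UO _ _ _]]; last first.
  exact: toggle_setK.
rewrite /S -sumrN; apply: eq_big => U; last first.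
  move=> /andP[bt /eqP tU]; apply: ncls_toggle.
  by rewrite -tU; apply: between_toggle.
apply/andP/idP => [[bt /eqP <-]|bU]; first exact: between_toggle.
by split; [apply: between_toggle|rewrite toggle_setK //; case/and4P: bU].
Qed.
End Toggle.

(** The inverse of [zeta]: the Moebius function of the lattice of open sets lives
    on the pairs with discrete difference. The sign is written as a product of
    one sign for each end, so that it telescopes along chains. *)
Definition moebius u : {ffun opens P -> K} :=
  [ffun V : opens P =>
     \sum_(W : opens P | (val W \subset val V) && qdiscrete_on P (val V :\: val W))
        (-1) ^+ (ncls P (val V) + ncls P (val W)) * u W].

Lemma zeta_moebius u : zeta (moebius u) = u.
Proof.
apply/ffunP => V; rewrite ffunE.
under eq_bigr => U _ do rewrite ffunE.
rewrite (exchange_big_dep (fun W : opens P => val W \subset val V)) /=; last first.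
  by move=> U W /andP[UV _] /andP[WU _]; apply: subset_trans UV.
rewrite (bigD1 V) //= (bigD1 V) /=; last first.
  by rewrite subxx setDv; apply/qdiscrete_onP => x y; rewrite inE.
rewrite exprD -expr2 sqrr_sign mul1r big1 ?addr0; last first.
  move=> U /andP[/andP[/andP[UV _] /andP[VU _]]].
  by rewrite -(inj_eq val_inj) eqEsubset UV VU.
rewrite big1 ?addr0 // => W /andP[WV WneV].
have [x /setDP[xV xW] x_max] : exists2 x, x \in val V :\: val W &
    {in val V :\: val W, forall y, P x y -> P y x}.
  apply: exists_maximal; rewrite setD_eq0; apply: contra WneV => VW.
  by rewrite -(inj_eq val_inj) eqEsubset WV.
under eq_bigr => U _ do rewrite exprD -mulrA.
rewrite -mulr_suml (_ : \sum_(U | _) _ = 0) ?mul0r //.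
rewrite -[RHS](sum_between0 xV xW x_max).
rewrite [RHS](reindex_onto val (insubd (opens0 P))) => [|U /and4P[UO _ _ _]]; last first.
  by rewrite insubdK.
apply: eq_bigl => U /=; rewrite valKd eqxx andbT andbT /between (valP U) /=.
by rewrite andbCA.
Qed.

Lemma iter_zeta_moebius u n : iter n (@zeta A P K) (iter n moebius u) = u.
Proof.
by elim: n => //= n IHn; rewrite -iterS iterSr /= zeta_moebius.
Qed.

Lemma iter_moebius n V :
  iter n moebius (at_empty P K) V =
  (-1) ^+ ncls P (val V) * iter n (@zeta_discrete A P K) (at_empty P K) V.
Proof.
elim: n V => [|n IHn] V /=.
  rewrite ffunE; case: eqP => [->|]; last by rewrite mulr0.
  by rewrite /ncls imset0 cards0 expr0 mul1r.
rewrite !ffunE mulr_sumr; apply: eq_bigr => W _.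
rewrite IHn mulrA; congr (_ * _); rewrite exprD -mulrA -expr2 sqrr_sign.
by rewrite mulr1.
Qed.

End Moebius.

Section Ehrhart.
Variables (K : fieldType) (A : finType) (P : qposet A).
Hypothesis K_char0 : [pchar K] =i pred0.
Implicit Types (p q : {poly K}).

Definition eval_full (u : {ffun opens P -> K}) : K := u (opensT P).

Fact eval_full_is_zmod_morphism : zmod_morphism eval_full.
Proof. by move=> u v; rewrite /eval_full !ffunE. Qed.

HB.instance Definition _ :=
  GRing.isZmodMorphism.Build {ffun opens P -> K} K eval_full
    eval_full_is_zmod_morphism.

Lemma card_Lmaps k :
  #|Lmaps P k|%:R = eval_full (iter k (@zeta A P K) (at_empty P K)).
Proof.
rewrite /eval_full iter_chain_stepT; congr _%:R; apply: eq_card => f.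
by rewrite inE; case: (f \in _) => //; apply/esym/forallP.
Qed.

Lemma card_Lstrmaps k :
  #|Lstrmaps P k|%:R = eval_full (iter k (@zeta_discrete A P K) (at_empty P K)).
Proof.
rewrite /eval_full iter_chain_stepT; congr _%:R; apply: eq_card => f.
rewrite !inE; case: ([forall i, _]) => //=.
apply/'forall_forallP/forallP => [H i|H x y].
  apply/qdiscrete_onP => x y; rewrite !inE => /eqP fx /eqP fy xy.
  by have := H x y; rewrite xy fx fy eqxx => /andP[].
apply/implyP => /andP[xy /eqP fxy].
have /qdiscrete_onP/(_ x y) := H (f y).
by rewrite !inE fxy eqxx /qeqv /= xy; apply.
Qed.

(** The value of [p] at [-m] is reached by shifting: the powers of [zeta] applied
    to [moebius^m] of the initial vector are the values of [p(X - m)] from the rank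
    [m + 1] on, hence from the rank [0] on. *)
Theorem ehrhart_reciprocity p q :
  (forall k, (0 < k)%N -> p.[k%:R] = #|Lmaps P k|%:R) ->
  (forall k, (0 < k)%N -> q.[k%:R] = #|Lstrmaps P k|%:R) ->
  q = (-1) ^+ cl P *: (p \Po (- 'X)).
Proof.
move=> pP qP; apply: (@poly_eq_nat _ K_char0 _ _ 1) => m m0.
rewrite qP // card_Lstrmaps hornerZ horner_comp hornerN hornerX.
(* [u] stands for [zeta^-m] applied to the initial vector. *)
pose u := iter m (@moebius K A P) (at_empty P K).
have Zu k : iter (m + k) (@zeta A P K) u = iter k (@zeta A P K) (at_empty P K).
  by rewrite addnC iterD iter_zeta_moebius.
have q0 : (p \Po ('X - m%:R%:P)).[0%:R] = eval_full u.
  apply: (@poly_unipotent _ K_char0 _ _ _ eval_full (@chain_stepD _ _ _ _)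
    (@zetaE A P K) u _ #|A|.+1 m.+1 _ _ 0%N); first exact: zeta_strict_nilpotent.
  move=> k mk; rewrite horner_comp hornerD hornerN hornerX hornerC -natrB 1?ltnW //.
  by rewrite pP ?subn_gt0 // card_Lmaps -Zu subnKC // ltnW.
move: q0; rewrite horner_comp hornerD hornerN hornerX hornerC add0r => ->.
by rewrite /eval_full /u iter_moebius cl_ncls mulrA -expr2 sqrr_sign mul1r.
Qed.

(** The [n]-th difference at [0] keeps only the chains with [n] nonempty layers. *)
Theorem ehrhart_lead_coef p n : (size p <= n.+1)%N ->
  (forall k, (0 < k)%N -> p.[k%:R] = #|Lmaps P k|%:R) ->
  p`_n *+ n`! = #|[set f in Lmaps P n | [forall i, [set x | f x == i] != set0]]|%:R.
Proof.
move=> ps pP; have pZ k : p.[k%:R] = eval_full (iter k (@zeta A P K) (at_empty P K)).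
  apply: (@poly_unipotent _ K_char0 _ _ _ eval_full (@chain_stepD _ _ _ _)
    (@zetaE A P K) _ _ #|A|.+1 1%N); first exact: zeta_strict_nilpotent.
  by move=> j j0; rewrite pP // card_Lmaps.
have := poly_iter_fdiff (@chain_stepD _ _ _ _) (@zetaE A P K) pZ n 0.
rewrite iter_fdiff // hornerC => ->; exact: iter_chain_stepT.
Qed.
End Ehrhart.

(** * Heap-orderings *)

Section HeapOrderings.
Variables (A : finType) (P : qposet A).

Fact qbar_proj_subproof x : qcls P x \in qclasses P.
Proof. by rewrite qclassesE imset_f. Qed.

Definition qbar_proj x : qbar_carrier P := Sub (qcls P x) (qbar_proj_subproof x).

Lemma qbar_projE x y : (qbar_proj x == qbar_proj y) = qeqv P x y.
Proof. by rewrite -(inj_eq val_inj) qcls_eq. Qed.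

Lemma qbar_proj_surj C : exists x, C = qbar_proj x.
Proof.
have /imsetP[x _ Cx] : val C \in qcls P @: setT by rewrite -qclassesE; apply: valP.
by exists x; apply: val_inj.
Qed.

Lemma qbar_le x y : qbar P (qbar_proj x) (qbar_proj y) = P x y.
Proof.
rewrite mk_qposetE; apply/exists_inP/idP => [[x']|xy].
  rewrite inE => /andP[xx' x'x] /exists_inP[y']; rewrite inE => /andP[yy' y'y] x'y'.
  exact: qle_trans xx' (qle_trans x'y' y'y).
exists x; first by rewrite inE qeqv_refl.
by apply/exists_inP; exists y; rewrite // inE qeqv_refl.
Qed.

(** A surjection onto [cl P] levels that is monotone on [P] factors through
    the quotient poset, where it is a bijection for cardinality reasons. *)
Lemma mu_surjections :
  mu P = #|[set f in Lmaps P (cl P) | [forall i, [set x | f x == i] != set0]]|.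
Proof.
pose comp (h : {ffun qbar_carrier P -> 'I_(cl P)}) : {ffun A -> 'I_(cl P)} :=
  [ffun x => h (qbar_proj x)].
have comp_inj : injective comp.
  move=> g h /ffunP gh; apply/ffunP => C; have [x ->] := qbar_proj_surj C.
  by have := gh x; rewrite !ffunE.
rewrite /mu -(card_imset _ comp_inj); apply: eq_card => f.
apply/imsetP/idP => [[h] | ].
  rewrite inE => /andP[/andP[_ /forallP hS] /'forall_forallP hM] ->.
  rewrite !inE; apply/andP; split.
    by apply/'forall_forallP => x y; rewrite !ffunE -qbar_le; apply: hM.
  apply/forallP => i; have /codomP[C ->] := hS i; have [x ->] := qbar_proj_surj C.
  by apply/set0Pn; exists x; rewrite inE ffunE.
rewrite !inE => /andP[/'forall_forallP fM /forallP fS].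
have fE x y : qeqv P x y -> f x = f y.
  move=> /andP[xy yx]; apply/val_inj/eqP; rewrite eqn_leq.
  by rewrite (implyP (fM x y) xy) (implyP (fM y x) yx).
have rep C : {x | C == qbar_proj x}.
  by apply: sigW; have [x ->] := qbar_proj_surj C; exists x.
pose h := [ffun C => f (sval (rep C))].
have hE x : h (qbar_proj x) = f x.
  rewrite ffunE; case: (rep _) => y /= /eqP/esym/eqP.
  by rewrite qbar_projE => /fE.
have fcomp : f = comp h by apply/ffunP => x; rewrite ffunE hE.
exists h => //; rewrite inE; apply/andP; split; last first.
  apply/'forall_forallP => C D; have [x ->] := qbar_proj_surj C.
  by have [y ->] := qbar_proj_surj D; rewrite qbar_le !hE.
have hS i : i \in codom h.
  have /set0Pn[x] := fS i; rewrite inE -hE => /eqP <-; exact: codom_f.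
apply/andP; split; last exact/forallP.
apply/card_uniqP; rewrite (eq_card (B := 'I_(cl P))); last by move=> i; rewrite hS.
by rewrite card_ord size_codom card_sig.
Qed.
End HeapOrderings.

(** * Connectedness and admissible equivalences *)

Section Preorders.
Variable A : finType.
Implicit Types (P Q E F : qposet A) (x y z : A).

Lemma connect_qle (r : rel A) Q :
  (forall x y, r x y -> Q x y) -> forall x y, connect r x y -> Q x y.
Proof.
move=> rQ x y /connectP[s]; elim: s x => [|z s IHs] x /= => [_ ->|/andP[xz zs] yE].
  exact: qle_refl.
exact: qle_trans (rQ _ _ xz) (IHs _ zs yE).
Qed.

Definition symmetrized P : rel A := [rel x y | P x y || P y x].

Fact qcon_refl P : reflexive (connect (symmetrized P)).
Proof. by move=> x; apply: connect0. Qed.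

Fact qcon_trans P : transitive (connect (symmetrized P)).
Proof. by move=> y x z; apply: connect_trans. Qed.

(** The equivalence whose classes are the connected components of [P]. *)
Definition qcon P : qposet A := mk_qposet (@qcon_refl P) (@qcon_trans P).

Lemma qcon_sym P : symmetric (qcon P).
Proof.
move=> x y; rewrite !mk_qposetE; apply: sym_connect_sym => {}x {}y.
by rewrite /symmetrized /= orbC.
Qed.

Lemma sub_qcon P x y : P x y -> qcon P x y.
Proof. by move=> xy; rewrite mk_qposetE connect1 // /symmetrized /= xy. Qed.

Lemma qcon_min P F : symmetric F -> (forall x y, P x y -> F x y) ->
  forall x y, qcon P x y -> F x y.
Proof.
move=> Fs PF x y; rewrite mk_qposetE; apply: connect_qle => {}x {}y /orP[|/PF].
  exact: PF.
by rewrite Fs.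
Qed.

Lemma qcon_mono P Q : (forall x y, P x y -> Q x y) ->
  forall x y, qcon P x y -> qcon Q x y.
Proof.
by move=> PQ; apply: qcon_min => [|x y /PQ]; [apply: qcon_sym|apply: sub_qcon].
Qed.

Lemma qquo_subl P E x y : P x y -> qquo P E x y.
Proof. by move=> xy; rewrite qquoE connect1 //= xy. Qed.

Lemma qquo_subr P E x y : E x y -> qquo P E x y.
Proof. by move=> xy; rewrite qquoE connect1 //= xy orbT. Qed.

Lemma qquo_min P E Q : (forall x y, P x y -> Q x y) -> (forall x y, E x y -> Q x y) ->
  forall x y, qquo P E x y -> Q x y.
Proof.
move=> PQ EQ x y; rewrite qquoE; apply: connect_qle => {}x {}y /orP[].
  exact: PQ.
exact: EQ.
Qed.

Fact qsym_refl P : reflexive (qeqv P). Proof. exact: qeqv_refl. Qed.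
Fact qsym_trans P : transitive (qeqv P). Proof. exact: qeqv_trans. Qed.
(** The equivalence [~_P]: the least admissible one, as [qcon P] is the greatest. *)
Definition qsym P : qposet A := mk_qposet (@qsym_refl P) (@qsym_trans P).

Lemma qsymE P x y : qsym P x y = qeqv P x y.
Proof. exact: mk_qposetE. Qed.

Lemma qsym_sym P : symmetric (qsym P).
Proof. by move=> x y; rewrite !qsymE qeqv_sym. Qed.

Lemma qeqv_symmetric E : symmetric E -> qeqv E =2 E.
Proof. by move=> Es x y; rewrite /qeqv /= (Es y x) andbb. Qed.

Lemma is_equivP E : reflect (symmetric E) (is_equiv E).
Proof.
by apply: (iffP 'forall_forallP) => [H x y|H x y]; apply/eqP; rewrite // H.
Qed.

End Preorders.

Section Connected.

(** A set that is open together with its complement is a union of classes of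
    the equivalence generated by [P], and conversely. *)
Lemma qconnectedP (A : finType) (P : qposet A) :
  reflect ((0 < #|A|)%N /\ forall x y, qcon P x y) (qconnected P).
Proof.
apply: (iffP andP) => -[A0 H]; split=> //.
  move=> x y; pose O := [set z | qcon P x z].
  have step z t : P z t -> qcon P x z = qcon P x t.
    move=> /sub_qcon zt; apply/idP/idP => H'; first exact: qle_trans zt.
    by apply: qle_trans H' _; rewrite qcon_sym.
  have : is_open P O && is_open P (~: O).
    apply/andP; split; apply/openP => z t; rewrite !inE => + /step zt; by rewrite zt.
  move/(implyP (forallP H O)); case/orP=> /eqP/setP; first by move/(_ x); rewrite !inE qle_refl.
  by move/(_ y); rewrite !inE.
apply/forallP => O; apply/implyP => /andP[/openP O1 /openP O2].
case: (set_0Vmem O) => [->|[x xO]]; first by rewrite eqxx.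
apply/orP; right; apply/eqP/setP => y; rewrite inE; have := H x y.
have step z t : P z t -> (z \in O) = (t \in O).
  move=> zt; apply/idP/idP => zO; first exact: O1 zO zt.
  by apply: contraTT zO => zO; have := O2 z t; rewrite !inE; apply.
rewrite mk_qposetE => /(closed_connect (a := mem O)) <- // {}z t.
by case/orP=> /step.
Qed.

(** Connectedness of the restriction of [P] to a class only sees the steps of [P]
    inside that class, which are those of [qcut P E]. Topologies on subtypes are
    thus replaced by inclusions between preorders on [A]. *)
Lemma connected_classesP (A : finType) (P E : qposet A) : symmetric E ->
  reflect (forall x y, E x y -> qcon (qcut P E) x y)
          [forall x, qconnected (qrestr P (qclass E x))].
Proof.
move=> Es; apply: (iffP forallP) => [H x y Exy|H x].
  have [_ con] := qconnectedP _ (H x).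
  have xx : x \in qclass E x by rewrite inE qle_refl.
  have xy : y \in qclass E x by rewrite inE.
  pose R : qposet {z | z \in qclass E x} := qpull val (qcon (qcut P E)).
  suff : R (Sub x xx) (Sub y xy) by rewrite qpullE.
  apply: qcon_min (con _ _) => u v; rewrite !qpullE; first exact: qcon_sym.
  move=> uv; apply: sub_qcon; rewrite qcutE uv.
  have := valP u; have := valP v; rewrite !inE => xv xu.
  by apply: qle_trans xv; rewrite Es.
have xx : x \in qclass E x by rewrite inE qle_refl.
pose x0 : {z | z \in qclass E x} := Sub x xx; pose Q := qcon (qrestr P (qclass E x)).
suff con (u : {z | z \in qclass E x}) : Q x0 u.
  apply/qconnectedP; split; first by apply/card_gt0P; exists x0.
  by move=> u v; apply: qle_trans (con v); rewrite qcon_sym.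
pose S := [set z | [exists v : {z | z \in qclass E x}, (val v == z) && Q x0 v]].
have xS : x \in S by rewrite inE; apply/existsP; exists x0; rewrite eqxx /= qle_refl.
have Exu : E x (val u) by have := valP u; rewrite inE.
have := H _ _ Exu; rewrite mk_qposetE.
have closS : closed (symmetrized (qcut P E)) (mem S).
  have step y z : symmetrized (qcut P E) y z -> y \in S -> z \in S.
    rewrite /symmetrized /= !qcutE => yz /[!inE]/existsP[v /andP[/eqP vy xv]].
    have Eyz : E y z by case/orP: yz => /andP[_] //; rewrite Es.
    have Ez : z \in qclass E x.
      by rewrite inE; apply: qle_trans Eyz; have := valP v; rewrite inE vy.
    apply/existsP; exists (Sub z Ez); rewrite eqxx /=; apply: qle_trans xv _.
    case/orP: yz => /andP[yz _]; last rewrite qcon_sym; apply: sub_qcon; by rewrite qpullE /= vy.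
  move=> y z yz; apply/idP/idP; first exact: step.
  by apply: step; rewrite /symmetrized /= orbC.
move=> /(closed_connect closS)/esym; rewrite xS inE => /existsP[v /andP[/eqP/val_inj -> //]].
Qed.

End Connected.

Section Admissible.
Variable A : finType.
Implicit Types (P Q E F : qposet A) (x y z : A).

Lemma qtriP E P :
  reflect [/\ symmetric E, forall x y, E x y -> qcon (qcut P E) x y &
             forall x y, qquo P E x y -> qquo P E y x -> E x y]
          (qtri E P).
Proof.
apply: (iffP and3P) => [[/is_equivP Es /(connected_classesP _ Es) H /'forall_forallP Q]|[Es H Q]].
  by split=> // x y xy yx; rewrite -(eqP (Q x y)); apply/andP.
split; [exact/is_equivP|exact/connected_classesP|].
apply/'forall_forallP => x y; apply/eqP; apply/andP/idP => [[]|xy]; first exact: Q.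
by split; apply: qquo_subr; rewrite // Es.
Qed.

(** The modular law [(P \/ E) /\ F = (P /\ F) \/ E] in the lattice of preorders,
    where [qquo] is the join and [qcut] the meet. It holds here because a path in
    [P \/ E] between two [F]-equivalent points never leaves their class: each of
    its points is above and below them in [P \/ F], whose equivalence is [F]. *)
Lemma qquo_modular P E F : symmetric F -> (forall x y, E x y -> F x y) ->
  (forall x y, qquo P F x y -> qquo P F y x -> F x y) ->
  qcut (qquo P E) F = qquo (qcut P F) E.
Proof.
move=> Fs EF QF; apply: qposetP => x y; rewrite qcutE; apply/andP/idP; last first.
  move=> xy; split; last first.
    by apply: qquo_min xy => // {}x {}y; rewrite qcutE => /andP[].
  apply: qquo_min xy => {}x {}y; last exact: qquo_subr.
  by rewrite qcutE => /andP[xy _]; apply: qquo_subl.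
have PEF u v : qquo P E u v -> qquo P F u v.
  apply: qquo_min => {}u {}v; first exact: qquo_subl.
  by move/EF; apply: qquo_subr.
case; rewrite {1}qquoE => /connectP[s]; elim: s x => [|z s IHs] x /=.
  by move=> _ -> _; apply: qle_refl.
move=> /andP[xz zs] yE Fxy; have zy : qquo P E z y.
  by rewrite qquoE; apply/connectP; exists s.
have xz' : qquo P E x z by rewrite qquoE; apply: connect1.
have yx : qquo P F y x by apply: qquo_subr; rewrite Fs.
have Fxz : F x z by apply: QF; [exact: PEF|exact: qle_trans (PEF _ _ zy) yx].
have Fzy : F z y by apply: qle_trans Fxy; rewrite Fs.
apply: qle_trans (IHs _ zs yE Fzy).
case/orP: xz => xz; last exact: qquo_subr.
by apply: qquo_subl; rewrite qcutE xz.
Qed.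

Lemma qtri_sub_qquo E F P : qtri E P -> qtri F (qquo P E) ->
  forall x y, E x y -> F x y.
Proof.
move=> /qtriP[Es _ _] /qtriP[_ _ QF] x y xy.
by apply: QF; apply/qquo_subl/qquo_subr; rewrite // Es.
Qed.

Lemma qtri_sub_qcut E F P : qtri F P -> qtri E (qcut P F) ->
  forall x y, E x y -> F x y.
Proof.
move=> /qtriP[Fs _ _] /qtriP[_ HE _] x y /HE; apply: qcon_min => // {}x {}y.
by rewrite !qcutE => /andP[/andP[]].
Qed.

Lemma qquoA P E F : (forall x y, E x y -> F x y) -> qquo (qquo P E) F = qquo P F.
Proof.
move=> EF; apply: qposetP => x y; apply/idP/idP.
  apply: qquo_min => {}x {}y; last exact: qquo_subr.
  by apply: qquo_min => {}x {}y; [apply: qquo_subl|move/EF; apply: qquo_subr].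
apply: qquo_min => {}x {}y; last exact: qquo_subr.
by move=> xy; apply/qquo_subl/qquo_subl.
Qed.

Lemma qcutA P E F : (forall x y, E x y -> F x y) -> qcut (qcut P F) E = qcut P E.
Proof.
move=> EF; apply: qposetP => x y; rewrite !qcutE.
by case: (boolP (E x y)) => [/EF ->|]; rewrite ?andbT ?andbF.
Qed.

(** The index sets of the two sides of the coassociativity of [delta] agree. *)
Lemma qtri_nested P E F :
  qtri E P && qtri F (qquo P E) = qtri F P && qtri E (qcut P F).
Proof.
apply/andP/andP => -[].
  move=> EP FPE; have EF := qtri_sub_qquo EP FPE.
  have /qtriP[Es EC EQ] := EP; have /qtriP[Fs FC FQ] := FPE.
  rewrite qquoA // in FQ; have mod := qquo_modular Fs EF FQ.
  have CE u v : E u v -> qcon (qcut P F) u v.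
    move/EC; apply: qcon_mono => {}u {}v; rewrite !qcutE.
    by case/andP=> -> /EF.
  split; apply/qtriP; split=> // x y.
  - move/FC; rewrite mod; apply: qcon_min => {x y}[|x y]; first exact: qcon_sym.
    by apply: qquo_min => // {}x {}y; apply: sub_qcon.
  - by rewrite qcutA //; apply: EC.
  by rewrite -mod !qcutE => /andP[xy _] /andP[yx _]; apply: EQ.
move=> FP EPF; have EF := qtri_sub_qcut FP EPF.
have /qtriP[Fs FC FQ] := FP; have /qtriP[Es EC EQ] := EPF.
rewrite qcutA // in EC; have mod := qquo_modular Fs EF FQ.
split; apply/qtriP; split=> // x y.
- have PEF u v : qquo P E u v -> qquo P F u v.
    apply: qquo_min => {}u {}v; first exact: qquo_subl.
    by move/EF; apply: qquo_subr.
  move=> xy yx; have Fxy : F x y by apply: FQ; apply: PEF.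
  by apply: EQ; rewrite -mod qcutE ?xy ?yx // Fs.
- move/FC; apply: qcon_mono => {}x {}y; rewrite !qcutE => /andP[xy ->].
  by rewrite qquo_subl.
by rewrite qquoA //; apply: FQ.
Qed.

End Admissible.

(** * Counting classes and components *)

Section ClassCount.
Variable A : finType.
Implicit Types (P Q E F : qposet A) (x y z : A).

(** When [~_P] refines [~_Q], the classes of [Q] are the images of those of [P]
    under saturation; the comparisons of [cl] below follow. *)
Lemma cl_as_image P Q : (forall x y, qeqv P x y -> qeqv Q x y) ->
  cl Q = #|(fun C : {set A} => [set y | [exists x in C, qeqv Q x y]]) @: qclasses P|.
Proof.
move=> PQ; rewrite /cl !qclassesE -imset_comp; congr #|pred_of_set _|.
apply: eq_in_imset => x _; apply/setP => y; rewrite !inE.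
apply/idP/exists_inP => [xy|[z]]; first by exists x; rewrite // inE qeqv_refl.
by rewrite inE => /PQ; apply: qeqv_trans.
Qed.

Lemma cl_mono P Q : (forall x y, qeqv P x y -> qeqv Q x y) -> (cl Q <= cl P)%N.
Proof. by move/cl_as_image => ->; apply: leq_imset_card. Qed.

Lemma cl_mono_eq P Q : (forall x y, qeqv P x y -> qeqv Q x y) -> cl Q = cl P ->
  qeqv P =2 qeqv Q.
Proof.
move=> PQ QP x y; apply/idP/idP; first exact: PQ.
set g := fun C : {set A} => [set y | [exists x in C, qeqv Q x y]].
have /imset_injP g_inj : #|g @: qclasses P| == #|qclasses P|.
  by rewrite -(cl_as_image PQ) QP.
have gE z : g (qcls P z) = qcls Q z.
  apply/setP => t; rewrite !inE; apply/exists_inP/idP => [[w]|zt].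
    by rewrite inE => /PQ; apply: qeqv_trans.
  by exists z; rewrite // inE qeqv_refl.
rewrite -!qcls_eq -!gE => /eqP gxy; apply/eqP; apply: g_inj gxy;
  by rewrite qclassesE imset_f.
Qed.

Lemma eq_cl P Q : qeqv P =2 qeqv Q -> cl P = cl Q.
Proof.
by move=> PQ; apply/eqP; rewrite eqn_leq !cl_mono // => x y; rewrite PQ.
Qed.

Lemma cl_empty P : #|A| = 0%N -> cl P = 0%N.
Proof.
move=> A0; rewrite /cl qclassesE; apply/eqP; rewrite cards_eq0 imset_eq0.
by rewrite -cards_eq0 cardsT A0.
Qed.

Lemma cl_total P : (0 < #|A|)%N -> (forall x y, P x y) -> cl P = 1%N.
Proof.
case/card_gt0P=> x _ Ptot; rewrite /cl qclassesE; apply/eqP/cards1P.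
exists (qcls P x); apply/setP => C; rewrite inE; apply/imsetP/eqP => [[y _ ->]|->].
  by apply/eqP; rewrite qcls_eq /qeqv /= !Ptot.
by exists x.
Qed.

Lemma cl1_qeqv P x y : cl P = 1%N -> qeqv P x y.
Proof.
move=> /eqP/cards1P[C defC]; have clsC z : qcls P z = C.
  by apply/set1P; rewrite -defC qclassesE imset_f.
by rewrite -qcls_eq !clsC.
Qed.

Lemma cl_qsym P : cl (qsym P) = cl P.
Proof.
by apply: eq_cl => x y; rewrite (qeqv_symmetric (@qsym_sym A P)) qsymE.
Qed.

Lemma cl_qquo E P : qtri E P -> cl (qquo P E) = cl E.
Proof.
move=> /qtriP[Es _ QE]; apply: eq_cl => x y; rewrite (qeqv_symmetric Es).
apply/andP/idP => [[]|xy]; first exact: QE.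
by split; apply: qquo_subr; rewrite // Es.
Qed.

Lemma qtri_qeqv E P x y : qtri E P -> qeqv P x y -> qeqv E x y.
Proof.
move=> /qtriP[Es _ QE] /andP[xy yx]; rewrite (qeqv_symmetric Es).
by apply: QE; apply: qquo_subl.
Qed.

Lemma cl_qtri E P : qtri E P -> (cl E <= cl P)%N.
Proof. by move=> EP; apply: cl_mono => x y; apply: qtri_qeqv. Qed.

Lemma qtri_qsym P : qtri (qsym P) P.
Proof.
apply/qtriP; split=> [|x y xy|x y xy yx]; first exact: qsym_sym.
  by apply: sub_qcon; rewrite qcutE xy andbT; move: xy; rewrite qsymE => /andP[].
have QP u v : qquo P (qsym P) u v -> P u v.
  by apply: qquo_min => // {}u {}v; rewrite qsymE => /andP[].
by rewrite qsymE /qeqv /= !QP.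
Qed.

Lemma qquo_qsym P : qquo P (qsym P) = P.
Proof.
apply: qposetP => x y; apply/idP/idP; last exact: qquo_subl.
by apply: qquo_min => // {}x {}y; rewrite qsymE => /andP[].
Qed.

Lemma qcut_qsym P : qcut P (qsym P) = qsym P.
Proof.
apply: qposetP => x y; rewrite qcutE qsymE; apply/andP/idP => [[] //|xy].
by split=> //; case/andP: xy.
Qed.

Lemma cl_qtri_eq E P : qtri E P -> cl E = cl P -> E = qsym P.
Proof.
move=> EP EPcl; have /qtriP[Es _ _] := EP.
apply: qposetP => x y; rewrite qsymE -(qeqv_symmetric Es); apply/esym.
by apply: cl_mono_eq EPcl _ _ => u v; apply: qtri_qeqv.
Qed.

(** The classes of [qcon P] are connected and contain every connected set that
    meets them, so they are the maximal connected sets. *)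
Lemma qcomponentsE P : qcomponents P = qclasses (qcon P).
Proof.
have conP (B : {set A}) x : qconnected (qrestr P B) -> x \in B -> B \subset qcls (qcon P) x.
  move=> /qconnectedP[_ con] xB; apply/subsetP => y yB.
  rewrite inE (qeqv_symmetric (@qcon_sym _ P)).
  pose R : qposet {z | z \in B} := qpull val (qcon P).
  suff : R (Sub x xB) (Sub y yB) by rewrite qpullE.
  apply: qcon_min (con _ _) => u v; rewrite !qpullE; first exact: qcon_sym.
  exact: sub_qcon.
have cls_con x : qconnected (qrestr P (qcls (qcon P) x)).
  have /forallP/(_ x) : [forall x, qconnected (qrestr P (qclass (qcon P) x))].
    apply/(connected_classesP P (@qcon_sym _ P)) => {}x y.
    by apply: qcon_mono => {}x {}y xy; rewrite qcutE xy sub_qcon.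
  suff -> : qclass (qcon P) x = qcls (qcon P) x by [].
  by apply/setP => y; rewrite !inE (qeqv_symmetric (@qcon_sym _ P)).
rewrite qclassesE; apply/setP => C; rewrite inE.
apply/maxsetP/imsetP => [[Ccon Cmax]|[x _ ->]].
  have /card_gt0P[[x xC] _] := proj1 (qconnectedP _ Ccon).
  by exists x => //; apply/esym/Cmax; [apply: cls_con|apply: conP].
split=> // B Bcon clsB; apply/eqP; rewrite eqEsubset clsB andbT.
by apply: conP => //; apply: (subsetP clsB); rewrite inE qeqv_refl.
Qed.

Lemma cc_qcon P : cc P = cl (qcon P).
Proof. by rewrite /cc qcomponentsE. Qed.

(** The classes of an admissible [E] are connected, so gluing them does not
    change the components. *)
Lemma cc_qquo E P : qtri E P -> cc (qquo P E) = cc P.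
Proof.
move=> /qtriP[_ EC _]; rewrite !cc_qcon; congr cl; apply: qposetP => x y.
apply/idP/idP; last by apply: qcon_mono => {}x {}y; apply: qquo_subl.
apply: qcon_min => {x y}[|x y]; first exact: qcon_sym.
apply: qquo_min => {}x {}y; first exact: sub_qcon.
by move/EC; apply: qcon_mono => {}x {}y; rewrite qcutE => /andP[].
Qed.

Lemma cc_connected P : qconnected P -> cc P = 1%N.
Proof. by move=> /qconnectedP[A0 con]; rewrite cc_qcon cl_total. Qed.

Lemma is_discreteP P : reflect (symmetric P) (is_discrete P).
Proof.
apply: (iffP 'forall_forallP) => [H x y|Ps x y]; last by rewrite qeqv_symmetric.
have xy u v : P u v -> P v u by rewrite (eqP (H u v)) => /andP[].
by apply/idP/idP; apply: xy.
Qed.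

Lemma cc_discrete P : is_discrete P -> cc P = cl P.
Proof.
move=> /is_discreteP Ps; rewrite cc_qcon; congr cl; apply: qposetP => x y.
by apply/idP/idP; [apply: qcon_min|apply: sub_qcon].
Qed.

End ClassCount.

Section SumsAndIsos.

Lemma cl_qsum (A B : finType) (P : qposet A) (Q : qposet B) :
  cl (qsum P Q) = (cl P + cl Q)%N.
Proof.
have clsl x : qcls (qsum P Q) (inl x) = inl @: qcls P x.
  apply/setP => -[y|y]; rewrite inE /qeqv /= !qsumE.
    by rewrite (mem_imset _ _ (@inl_inj _ _)) inE.
  by apply/esym/negbTE/imsetP => -[].
have clsr x : qcls (qsum P Q) (inr x) = inr @: qcls Q x.
  apply/setP => -[y|y]; rewrite inE /qeqv /= !qsumE.
    by apply/esym/negbTE/imsetP => -[].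
  by rewrite (mem_imset _ _ (@inr_inj _ _)) inE.
have img_inj (C D : finType) (f : C -> D) : injective f -> injective (fun S : {set C} => f @: S).
  move=> fI S T /setP ST; apply/setP => x.
  by have := ST (f x); rewrite !(mem_imset _ _ fI).
rewrite /cl !qclassesE.
have -> : qcls (qsum P Q) @: setT =
  (fun S : {set A} => inl @: S) @: (qcls P @: setT) :|:
  (fun S : {set B} => inr @: S) @: (qcls Q @: setT).
  apply/setP => C; rewrite inE -!imset_comp; apply/imsetP/orP.
    case=> -[x|x] _ ->; [left|right]; apply/imsetP; exists x; rewrite // ?clsl ?clsr //.
  by case=> /imsetP[x _ ->]; [exists (inl x)|exists (inr x)]; rewrite // ?clsl ?clsr.
rewrite cardsU (_ : _ :&: _ = set0) ?cards0 ?subn0.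
  by rewrite !(card_imset _ (img_inj _ _ _ (@inl_inj A B)),
               card_imset _ (img_inj _ _ _ (@inr_inj A B))).
apply/setP => C; rewrite !inE -!imset_comp; apply/negbTE/negP => /andP[].
case/imsetP=> x _ -> /imsetP[y _ /setP/(_ (inl x))] /=.
rewrite mem_imset ?inE ?qeqv_refl; last exact: inl_inj.
by move/esym/imsetP => -[].
Qed.

Lemma qcon_qsum (A B : finType) (P : qposet A) (Q : qposet B) :
  qcon (qsum P Q) = qsum (qcon P) (qcon Q).
Proof.
apply: qposetP => u v; apply/idP/idP.
  apply: qcon_min => [[x|x] [y|y]|[x|x] [y|y]]; rewrite !qsumE //; try exact: qcon_sym.
  - exact: sub_qcon.
  - exact: sub_qcon.
have L x y : qcon P x y -> qcon (qsum P Q) (inl x) (inl y).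
  pose R := qpull inl (qcon (qsum P Q)); suff : qcon P x y -> R x y by rewrite qpullE.
  apply: qcon_min => {}x {}y; rewrite !qpullE; first exact: qcon_sym.
  by move=> xy; apply: sub_qcon; rewrite qsumE.
have R x y : qcon Q x y -> qcon (qsum P Q) (inr x) (inr y).
  pose R := qpull inr (qcon (qsum P Q)); suff : qcon Q x y -> R x y by rewrite qpullE.
  apply: qcon_min => {}x {}y; rewrite !qpullE; first exact: qcon_sym.
  by move=> xy; apply: sub_qcon; rewrite qsumE.
by case: u v => [x|x] [y|y]; rewrite qsumE //; [apply: L|apply: R].
Qed.

Lemma cc_qsum (A B : finType) (P : qposet A) (Q : qposet B) :
  cc (qsum P Q) = (cc P + cc Q)%N.
Proof. by rewrite !cc_qcon qcon_qsum cl_qsum. Qed.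

Lemma cc_iso (A B : finType) (P : qposet A) (Q : qposet B) :
  qiso P Q -> cc P = cc Q.
Proof.
case/qisoP=> f fB ->; have [g fK gK] := fB; rewrite !cc_qcon.
suff -> : qcon (qpull f Q) = qpull f (qcon Q) by apply/cl_iso/qiso_pull.
apply: qposetP => x y; apply/idP/idP.
  apply: qcon_min => {}x {}y; rewrite !qpullE; first exact: qcon_sym.
  exact: sub_qcon.
rewrite qpullE => xy; pose R := qpull g (qcon (qpull f Q)).
suff : R (f x) (f y) by rewrite qpullE !fK.
apply: qcon_min xy => {}x {}y; rewrite !qpullE; first exact: qcon_sym.
by move=> xy; apply: sub_qcon; rewrite qpullE !gK.
Qed.

Lemma qiso_clopen (A : finType) (P : qposet A) (O : {set A}) :
  is_open P O -> is_open P (~: O) ->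
  qiso (qsum (qrestr P O) (qrestr P (~: O))) P.
Proof.
move=> /openP O1 /openP O2.
pose f (u : {x | x \in O} + {x | x \in ~: O}) : A :=
  match u with inl x => val x | inr x => val x end.
apply/qisoP; exists f; last first.
  apply: qposetP => -[x|x] [y|y]; rewrite qpullE qsumE ?qpullE //=; apply/esym/negbTE/negP.
    by move/(O1 _ _ (valP x)); have := valP y; rewrite inE => /negbTE ->.
  by move/(O2 _ _ (valP x)); have := valP y; rewrite !inE => ->.
apply: inj_card_bij => [[x|x] [y|y] /= xy|].
- by congr inl; apply: val_inj.
- by have /setCP[] := valP y; rewrite -(xy : val x = val y); apply: valP.
- by have /setCP[] := valP x; rewrite (xy : val x = val y); apply: valP.
- by congr inr; apply: val_inj.
by rewrite card_sum !card_sig cardsC.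
Qed.

(** Reduces identities between multiplicative functions to the connected case. *)
Lemma qposet_connected_ind (Pr : forall A : finType, qposet A -> Prop) :
  (forall (A : finType) (P : qposet A), #|A| = 0%N -> Pr A P) ->
  (forall (A : finType) (P : qposet A), qconnected P -> Pr A P) ->
  (forall (A : finType) (P : qposet A) (O : {set A}),
     is_open P O -> is_open P (~: O) ->
     Pr _ (qrestr P O) -> Pr _ (qrestr P (~: O)) -> Pr A P) ->
  forall (A : finType) (P : qposet A), Pr A P.
Proof.
move=> Pr0 Pr1 Pr2 A P; have [n] := ubnP #|A|; elim: n A P => // n IHn A P; rewrite ltnS => An.
case: (posnP #|A|) => [|A0]; first exact: Pr0.
case: (boolP (qconnected P)) => [|]; first exact: Pr1.
rewrite /qconnected A0 /= negb_forall => /existsP[O].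
rewrite negb_imply negb_or => /andP[/andP[O1 O2] /andP[O0 OT]].
have lt (B : {set A}) : B != setT -> (#|{: {x | x \in B}}| < n)%N.
  move=> BT; rewrite card_sig; apply: leq_trans An; rewrite -cardsT.
  by apply: proper_card; rewrite properT.
apply: (Pr2 _ _ O) => //; apply: IHn; apply: lt => //.
by apply: contra O0 => /eqP OC; rewrite -[O]setCK OC setCT.
Qed.

End SumsAndIsos.

(** * Characters and their convolution *)

Section ConvolutionOnOneSet.
Variables (K : fieldType) (A : finType).
Implicit Types (f g h : qposet A -> K) (P E F : qposet A).

(** All the quasi-posets that occur in [delta P] live on the same set, so the
    convolution of characters can be studied there, for arbitrary functions. *)
Definition qconv f g P : K := \sum_(E | qtri E P) f (qquo P E) * g (qcut P E).

(** Both sides sum over the pairs [E], [F] of equivalences with [E] finer than [F]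
    described by [qtri_nested]; the three arguments agree, the middle one by the
    modular law. *)
Lemma qconvA f g h P :
  qconv (qconv f g) h P = qconv f (qconv g h) P.
Proof.
rewrite /qconv; under eq_bigr => E _ do rewrite mulr_suml.
under [RHS]eq_bigr => F _ do rewrite mulr_sumr.
rewrite (exchange_big_dep (fun F => qtri F P)) /= => [|E F EP FPE]; last first.
  by have := qtri_nested P E F; rewrite EP FPE => /esym/andP[].
apply: eq_bigr => F FP; apply: eq_big => [E|E /andP[EP FPE]].
  by rewrite qtri_nested FP.
have EF := qtri_sub_qquo EP FPE; have /qtriP[Fs _ FQ] := FP.
by rewrite mulrA qquoA // qcutA // -qquo_modular.
Qed.

Lemma qtri_discrete E P : qtri E P -> is_discrete (qcut P E) -> E = qsym P.
Proof.
move=> /qtriP[Es EC EQ] /is_discreteP Ds; apply: qposetP => x y; rewrite qsymE.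
have sub u v : E u v -> P u v.
  by move/EC/(qcon_min Ds (fun _ _ => id)); rewrite qcutE => /andP[].
apply/idP/andP => [xy|[xy yx]]; first by rewrite !sub // Es.
by apply: EQ; apply: qquo_subl.
Qed.

Lemma qsym_discrete P : is_discrete (qsym P).
Proof. exact/is_discreteP/qsym_sym. Qed.

Lemma qtri_quo_discrete E P : qtri E P -> is_discrete (qquo P E) -> E = qcon P.
Proof.
move=> /qtriP[Es EC EQ] /is_discreteP Ds.
apply: qposetP => x y; apply/idP/idP.
  by move/EC; apply: qcon_mono => {}x {}y; rewrite qcutE => /andP[].
apply: qcon_min => // {}x {}y xy.
by apply: EQ; last rewrite Ds; apply: qquo_subl.
Qed.

Lemma qcut_qcon P : qcut P (qcon P) = P.
Proof.
apply: qposetP => x y; rewrite qcutE.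
by case: (boolP (P x y)) => [/sub_qcon|].
Qed.

Lemma qquo_qcon P : qquo P (qcon P) = qcon P.
Proof.
apply: qposetP => x y; apply/idP/idP; last exact: qquo_subr.
by apply: qquo_min => // {}x {}y; apply: sub_qcon.
Qed.

Lemma qtri_qcon P : qtri (qcon P) P.
Proof.
apply/qtriP; split=> [|x y|x y]; first exact: qcon_sym.
  by rewrite qcut_qcon.
by rewrite qquo_qcon.
Qed.

Lemma qconv_counitr f P : qconv f (fun Q => (is_discrete Q)%:R) P = f P.
Proof.
rewrite /qconv (bigD1 (qsym P)) ?qtri_qsym //= qquo_qsym qcut_qsym.
rewrite qsym_discrete mulr1 big1 ?addr0 // => E /andP[EP /eqP ne].
by case: (boolP (is_discrete _)) => [/(qtri_discrete EP)|]; rewrite ?mulr0.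
Qed.

Lemma qconv_counitl f P : qconv (fun Q => (is_discrete Q)%:R) f P = f P.
Proof.
rewrite /qconv (bigD1 (qcon P)) ?qtri_qcon //= qquo_qcon qcut_qcon.
have -> : is_discrete (qcon P) by apply/is_discreteP/qcon_sym.
rewrite mul1r big1 ?addr0 // => E /andP[EP /eqP ne].
by case: (boolP (is_discrete _)) => [/(qtri_quo_discrete EP)|]; rewrite ?mul0r.
Qed.

(** The term [E = qsym P] of [qconv f g P] is [f P], and every other one
    evaluates [f] on a quasi-poset with fewer classes. *)
Lemma qconv_injl f1 f2 g : (forall P, is_discrete P -> g P = 1) ->
  qconv f1 g =1 qconv f2 g -> f1 =1 f2.
Proof.
move=> g1 ff P; have [n] := ubnP (cl P); elim: n P => // n IHn P; rewrite ltnS => Pn.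
have := ff P; rewrite /qconv !(bigD1 (P := fun E => qtri E P) (qsym P)) ?qtri_qsym //=.
rewrite qquo_qsym qcut_qsym g1 ?qsym_discrete // !mulr1.
rewrite [X in _ + X](_ : _ = \sum_(E | qtri E P && (E != qsym P))
  f2 (qquo P E) * g (qcut P E)); first exact: addIr.
apply: eq_bigr => E /andP[EP /eqP ne]; rewrite IHn // (leq_trans _ Pn) // cl_qquo //.
by rewrite ltn_neqAle cl_qtri // andbT; apply/eqP => /(cl_qtri_eq EP).
Qed.

End ConvolutionOnOneSet.

Section Characters.
Variable K : fieldType.
Implicit Types (chi : character K).

Lemma qb_iso (A B : finType) (P : qposet A) (Q : qposet B) :
  qiso P Q -> qb P = qb Q :> Hqp K.
Proof. by move/isoclassP => PQ; rewrite /qb PQ. Qed.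

Lemma qb_qsum (A B : finType) (P : qposet A) (Q : qposet B) :
  qb (qsum P Q) = qb P * qb Q :> Hqp K.
Proof.
rewrite /qb malgM_def fgmulUU mulr1; congr << _ >>.
by rewrite -iso_mulE.
Qed.

Lemma qb_empty (A : finType) (P : qposet A) : #|A| = 0%N -> qb P = 1 :> Hqp K.
Proof.
move=> A0; rewrite -mpolyC1E /qb; congr << _ >>; apply/isoclassP.
apply: qiso_trans (qiso_sum0 P qempty card_void) _.
apply: qiso_trans (qiso_sumC _ _) _.
by rewrite qiso_sym; apply: qiso_sum0.
Qed.

Lemma chi_clopen chi (A : finType) (P : qposet A) (O : {set A}) :
  is_open P O -> is_open P (~: O) ->
  chi (qb P) = chi (qb (qrestr P O)) * chi (qb (qrestr P (~: O))).
Proof.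
by move=> O1 O2; rewrite -rmorphM -qb_qsum (qb_iso (qiso_clopen O1 O2)).
Qed.

Lemma cl_clopen (A : finType) (P : qposet A) (O : {set A}) :
  is_open P O -> is_open P (~: O) ->
  cl P = (cl (qrestr P O) + cl (qrestr P (~: O)))%N.
Proof. by move=> O1 O2; rewrite -cl_qsum (cl_iso (qiso_clopen O1 O2)). Qed.

Lemma cc_clopen (A : finType) (P : qposet A) (O : {set A}) :
  is_open P O -> is_open P (~: O) ->
  cc P = (cc (qrestr P O) + cc (qrestr P (~: O)))%N.
Proof. by move=> O1 O2; rewrite -cc_qsum (cc_iso (qiso_clopen O1 O2)). Qed.

Lemma cc_empty (A : finType) (P : qposet A) : #|A| = 0%N -> cc P = 0%N.
Proof. by move=> A0; rewrite cc_qcon cl_empty. Qed.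

Lemma conv_qb (f g : Hqp K -> K) (A : finType) (P : qposet A) :
  conv f g (qb P) = qconv (fun Q => f (qb Q)) (fun Q => g (qb Q)) P.
Proof.
rewrite /conv delta_qb /delta_qposet linear_sum /=.
by apply: eq_bigr => E _; rewrite lextU.
Qed.

Lemma leftact_qb (phi : Hqp K -> {poly K}) (f : Hqp K -> K) (A : finType) (P : qposet A) :
  leftact phi f (qb P) =
  \sum_(E | qtri E P) f (qb (qcut P E)) *: phi (qb (qquo P E)).
Proof.
rewrite /leftact delta_qb /delta_qposet linear_sum /=.
by apply: eq_bigr => E _; rewrite lextU.
Qed.

Lemma lext_sum (I : choiceType) (V : lmodType K) (F : I -> V) (T : Type) (s : seq T)
    (c : T -> K) (h : T -> {malg K[I]}) :
  lext F (\sum_(a <- s) c a *: h a) = \sum_(a <- s) c a *: lext F (h a).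
Proof. by rewrite linear_sum; apply: eq_bigr => a _; rewrite linearZ. Qed.

Lemma conv_epsilon'P (f g : Hqp K -> K) :
  (forall (A : finType) (P : qposet A), conv f g (qb P) = epsilon' (qb P)) ->
  conv f g =1 @epsilon' K.
Proof.
(* Both sides are, by definition, linear combinations of their values on the
   representatives, with the coefficients of [h]. *)
move=> fg h; have E := lext_sum (V := K^o)
  (fun ab : isoclasses * isoclasses => f << ab.1 >> * g << ab.2 >>)
  (msupp h) (mcoeff^~ h) (fun a => delta_qposet K (rep a)).
apply: (etrans E).
apply: eq_bigr => a _; congr (_ *: _).
by have := fg _ (rep a); rewrite epsilon'_qb /conv delta_qb.
Qed.

(** Twisting a character by the sign [(-1) ^+ (cl P + cc P)], which is
    multiplicative because [cl] and [cc] are additive. *)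
Section SignTwist.
Variable chi : character K.

Definition sign_twist_iso (a : isoclasses) : K :=
  (-1) ^+ (cl (rep a) + cc (rep a)) * chi << a >>.

Lemma sign_twist_isoE (A : finType) (P : qposet A) :
  sign_twist_iso (isoclass P) = (-1) ^+ (cl P + cc P) * chi (qb P).
Proof.
by rewrite /sign_twist_iso (cl_iso (rep_isoclass P)) (cc_iso (rep_isoclass P)).
Qed.

Fact sign_twist_iso_mmorphism : mmorphism sign_twist_iso.
Proof.
split=> [a b|].
  rewrite -[a]isoclass_rep -[b]isoclass_rep.
  have -> : mmul (isoclass (rep a)) (isoclass (rep b)) = isoclass (qsum (rep a) (rep b)).
    exact: iso_mulE.
  rewrite !sign_twist_isoE qb_qsum rmorphM cl_qsum cc_qsum.
  by rewrite addnACA exprD mulrACA.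
have -> : mone = isoclass qempty :> isoclasses by [].
by rewrite sign_twist_isoE qb_empty ?card_void // rmorph1 cl_empty ?cc_empty ?card_void // mulr1.
Qed.

HB.instance Definition _ :=
  monalg.isMultiplicative.Build isoclasses K sign_twist_iso sign_twist_iso_mmorphism.

Definition sign_twist : character K := mmap idfun sign_twist_iso.

Lemma sign_twist_qb (A : finType) (P : qposet A) :
  sign_twist (qb P) = (-1) ^+ (cl P + cc P) * chi (qb P).
Proof. by rewrite /= mmapU mul1r sign_twist_isoE. Qed.

End SignTwist.
End Characters.

(** * Ehrhart polynomials through the homogeneous morphism *)

Section HomogeneousMorphism.
Variables (K : fieldType) (phi0 : Hqp K -> {poly K}) (lambda : character K).
Hypothesis phi0_total : forall (A : finType) (P : qposet A),
  (0 < #|A|)%N -> (forall x y, P x y) -> phi0 (qb P) = 'X.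
Hypothesis phi0E : forall (A : finType) (P : qposet A),
  phi0 (qb P) = lambda (qb P) *: 'X^(cl P).

Lemma lambda_total (A : finType) (P : qposet A) :
  (0 < #|A|)%N -> (forall x y, P x y) -> lambda (qb P) = 1.
Proof.
move=> A0 Ptot; have := phi0E P; rewrite phi0_total // cl_total //.
by move/(congr1 (fun p : {poly K} => p`_1)); rewrite coefZ !coefX mulr1.
Qed.

Lemma leftact_phi0 (f : Hqp K -> K) (A : finType) (P : qposet A) :
  leftact phi0 f (qb P) =
  \sum_(E | qtri E P) (f (qb (qcut P E)) * lambda (qb (qquo P E))) *: 'X^(cl E).
Proof.
rewrite leftact_qb; apply: eq_bigr => E EP.
by rewrite phi0E scalerA cl_qquo.
Qed.

Lemma coef_leftact_phi0 (f : Hqp K -> K) (A : finType) (P : qposet A) i :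
  (leftact phi0 f (qb P))`_i =
  \sum_(E | qtri E P && (cl E == i)) f (qb (qcut P E)) * lambda (qb (qquo P E)).
Proof.
rewrite leftact_phi0 coef_sum [RHS]big_mkcondr; apply: eq_bigr => E _.
by rewrite coefZ coefXn eq_sym; case: eqP; rewrite ?mulr1 ?mulr0.
Qed.

Lemma size_leftact_phi0 (f : Hqp K -> K) (A : finType) (P : qposet A) :
  (size (leftact phi0 f (qb P)) <= (cl P).+1)%N.
Proof.
apply/leq_sizeP => j Pj; rewrite coef_leftact_phi0 big1 // => E /andP[EP /eqP Ej].
by have := cl_qtri EP; rewrite Ej leqNgt Pj.
Qed.

(** For a connected [P], only the total equivalence contributes a linear term. *)
Lemma coef1_leftact_phi0 (f : Hqp K -> K) (A : finType) (P : qposet A) :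
  qconnected P -> (leftact phi0 f (qb P))`_1 = f (qb P).
Proof.
move=> /qconnectedP[A0 con]; rewrite coef_leftact_phi0 (big_pred1 (qcon P)) => [|E].
  rewrite qcut_qcon qquo_qcon lambda_total ?mulr1 //.
rewrite /=; apply/andP/eqP => [[EP /eqP E1]|->]; last first.
  by rewrite qtri_qcon cl_total.
have /qtriP[Es _ _] := EP; apply: qposetP => x y; rewrite con.
by rewrite -(qeqv_symmetric Es); apply: cl1_qeqv.
Qed.

Lemma lead_coef_leftact_phi0 (f : Hqp K -> K) (A : finType) (P : qposet A) :
  (leftact phi0 f (qb P))`_(cl P) = f (qb (qsym P)) * lambda (qb P).
Proof.
rewrite coef_leftact_phi0 (big_pred1 (qsym P)) => [|E].
  by rewrite qcut_qsym qquo_qsym.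
rewrite /=; apply/andP/eqP => [[EP /eqP]|->]; first exact: cl_qtri_eq.
by rewrite qtri_qsym cl_qsym.
Qed.

Variables (ehr : {linear Hqp K -> {poly K}}) (alpha : character K).
Hypotheses (ehrP : is_ehr ehr) (ehrE : ehr =1 leftact phi0 alpha).

Lemma ehr1 (A : finType) (P : qposet A) : (ehr (qb P)).[1] = 1.
Proof.
rewrite -[1 in LHS](mulr1n 1) ehrP // (_ : Lmaps P 1 = setT); last first.
  apply/setP => f; rewrite !inE; apply/'forall_forallP => x y.
  by rewrite !ord1 implybT.
by rewrite cardsT card_ffun card_ord exp1n.
Qed.

(** On a nonempty total quasi-poset the expansion of [ehr] is [alpha_P X], whose
    value at [1] counts the maps to a point. *)
Lemma alpha_discrete (A : finType) (P : qposet A) :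
  is_discrete P -> alpha (qb P) = 1.
Proof.
move: A P; apply: (qposet_connected_ind (Pr := fun A P => is_discrete P -> alpha (qb P) = 1))
  => [A P A0 _|A P con dis|A P O O1 O2 IH1 IH2 dis].
- by rewrite qb_empty ?rmorph1.
- have /qconnectedP[A0 qtot] := con; have /is_discreteP Ps := dis.
  have qconE : qcon P = P.
    by apply: qposetP => x y; apply/idP/idP; [apply: qcon_min|apply: sub_qcon].
  rewrite qconE in qtot; have := ehr1 P; rewrite ehrE leftact_phi0.
  rewrite (big_pred1 P) => [|E].
    rewrite cl_total // hornerZ hornerX mulr1.
    have -> : qquo P P = P by rewrite -{2}qconE qquo_qcon.
    have -> : qcut P P = P by rewrite -{2}qconE qcut_qcon.
    by rewrite lambda_total // mulr1.
  apply/idP/eqP => [EP|->]; last by rewrite -{1}qconE qtri_qcon.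
  apply: qposetP => x y; rewrite qtot.
  have /qtriP[Es _ _] := EP; rewrite -(qeqv_symmetric Es).
  by apply: (qtri_qeqv EP); rewrite /qeqv /= !qtot.
have dis_restr B : is_discrete (qrestr P B).
  by apply/is_discreteP => x y; rewrite !qpullE; apply/is_discreteP.
apply: etrans (chi_clopen alpha O1 O2) _.
exact: etrans (congr2 *%R (IH1 (dis_restr _)) (IH2 (dis_restr _))) (mulr1 1).
Qed.

(** The leading coefficient of [ehr_P], computed from the expansion and from the
    count of surjections. *)
Lemma lambda_mu (K_char0 : [pchar K] =i pred0) (A : finType) (P : qposet A) :
  lambda (qb P) = (mu P)%:R / (cl P)`!%:R.
Proof.
have size_ehr : (size (ehr (qb P)) <= (cl P).+1)%N by rewrite ehrE size_leftact_phi0.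
have := ehrhart_lead_coef K_char0 size_ehr (@ehrP A P).
rewrite -mu_surjections ehrE lead_coef_leftact_phi0.
rewrite alpha_discrete ?qsym_discrete // mul1r => muE.
have n0 : (cl P)`!%:R != 0 :> K by rewrite natr_eq0_char0 // -lt0n fact_gt0.
by apply: (canRL (mulfK n0)); rewrite mulr_natr.
Qed.

Variable ehr_str : {linear Hqp K -> {poly K}}.
Hypothesis ehr_strP : is_ehr_str ehr_str.
Hypothesis duality : forall (A : finType) (P : qposet A),
  ehr_str (qb P) = (-1) ^+ cl P *: (ehr (qb P) \Po (- 'X)).

Lemma ehr_str1 (A : finType) (P : qposet A) :
  (ehr_str (qb P)).[1] = (is_discrete P)%:R.
Proof.
rewrite -[1 in LHS](mulr1n 1) ehr_strP //.
case: is_discreteP => dis.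
  rewrite (_ : Lstrmaps P 1 = setT) ?cardsT ?card_ffun ?card_ord ?exp1n //.
  apply/setP => f; rewrite !inE; apply/andP; split.
    by apply/'forall_forallP => x y; rewrite !ord1 implybT.
  apply/'forall_forallP => x y; apply/implyP => /andP[xy _].
  by rewrite /qeqv /= (dis y x) xy.
rewrite (_ : Lstrmaps P 1 = set0) ?cards0 //; apply/setP => f; rewrite !inE.
apply/negP => /andP[_ /'forall_forallP H]; apply: dis.
have step x y : P x y -> P y x.
  by move=> xy; have := H x y; rewrite xy !ord1 eqxx => /andP[].
by move=> x y; apply/idP/idP; apply: step.
Qed.

(** The signs turn the convolution at [P] into [(-1)^cc(P) ehr_P(-1)], because
    [cc(P/~) = cc(P)] and [lambda] of [P/~] sits in degree [cl(P/~)]; by duality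
    this counts the strict maps from [P] to one point. *)
Lemma sign_twist_conv : conv (sign_twist lambda) alpha =1 @epsilon' K.
Proof.
apply: conv_epsilon'P => A P; rewrite conv_qb epsilon'_qb /qconv.
transitivity ((-1) ^+ cc P * (ehr (qb P)).[-1]).
  rewrite ehrE leftact_phi0 horner_sum mulr_sumr; apply: eq_bigr => E EP.
  rewrite sign_twist_qb cl_qquo // cc_qquo // hornerZ hornerXn exprD.
  by rewrite [RHS]mulrC [LHS]mulrC [X in _ * X = _]mulrC !mulrA.
have := duality P => /(congr1 (horner^~ 1)); rewrite ehr_str1 hornerZ horner_comp.
rewrite hornerN hornerX => dualE.
have -> : (ehr (qb P)).[-1] = (-1) ^+ cl P * (is_discrete P)%:R.
  by rewrite dualE mulrA -expr2 sqrr_sign mul1r.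
case: (boolP (is_discrete P)) => [/cc_discrete ->|_]; last by rewrite !mulr0.
by rewrite mulr1 -expr2 sqrr_sign.
Qed.

Lemma conv_inj (beta beta' : character K) :
  conv beta alpha =1 conv beta' alpha ->
  forall (A : finType) (P : qposet A), beta (qb P) = beta' (qb P).
Proof.
move=> bb A; apply: (qconv_injl (g := fun Q => alpha (qb Q))) => [P|P].
  exact: alpha_discrete.
by rewrite -!conv_qb.
Qed.

(** A left inverse is also a right inverse: [(alpha * beta) * alpha = alpha], and
    convolution by [alpha] on the right is injective. *)
Lemma left_inverse_is_inverse (beta : character K) :
  conv beta alpha =1 @epsilon' K -> is_inverse alpha beta.
Proof.
move=> ba; split=> //; apply: conv_epsilon'P => A P; rewrite conv_qb epsilon'_qb.
move: P; apply: (qconv_injl (g := fun Q => alpha (qb Q))) => [P|P].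
  exact: alpha_discrete.
rewrite qconvA qconv_counitl.
apply: etrans _ (qconv_counitr (fun Q => alpha (qb Q)) P).
apply: eq_bigr => E _; congr (_ * _).
by rewrite -conv_qb ba epsilon'_qb.
Qed.

End HomogeneousMorphism.

Section DualityOfCharacters.

Lemma coef1_comp_oppX (R : comNzRingType) (p : {poly R}) :
  (p \Po (- 'X))`_1 = - p`_1.
Proof.
have c1 (q : {poly R}) : q`_1 = q^`().[0] by rewrite horner_coef0 coef_deriv.
rewrite !c1 deriv_comp derivN derivX mulrN1 hornerN horner_comp.
by rewrite hornerN hornerX oppr0.
Qed.

Variables (K : fieldType) (phi0 : Hqp K -> {poly K}) (lambda : character K).
Hypothesis phi0_total : forall (A : finType) (P : qposet A),
  (0 < #|A|)%N -> (forall x y, P x y) -> phi0 (qb P) = 'X.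
Hypothesis phi0E : forall (A : finType) (P : qposet A),
  phi0 (qb P) = lambda (qb P) *: 'X^(cl P).
Variables (ehr ehr_str : {linear Hqp K -> {poly K}}) (alpha alpha_str : character K).
Hypotheses (ehrE : ehr =1 leftact phi0 alpha)
           (ehr_strE : ehr_str =1 leftact phi0 alpha_str).
Hypothesis duality : forall (A : finType) (P : qposet A),
  ehr_str (qb P) = (-1) ^+ cl P *: (ehr (qb P) \Po (- 'X)).

(** For connected [P] the two values are the linear coefficients of [ehr_P] and
    [ehrstr_P], and [X |-> -X] changes the sign of a linear coefficient. *)
Lemma alpha_alpha_str (A : finType) (P : qposet A) :
  alpha (qb P) = (-1) ^+ (cl P + cc P) * alpha_str (qb P).
Proof.
move: A P; apply: qposet_connected_ind => [A P A0|A P con|A P O O1 O2 IH1 IH2].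
- by rewrite !qb_empty ?rmorph1 // cl_empty ?cc_empty // mulr1.
- rewrite cc_connected // -(coef1_leftact_phi0 phi0_total phi0E alpha con).
  rewrite -(coef1_leftact_phi0 phi0_total phi0E alpha_str con) -ehrE -ehr_strE duality.
  rewrite coefZ mulrA -exprD addnAC addnn addn1 exprS -signr_odd odd_double mulr1.
  by rewrite coef1_comp_oppX mulN1r opprK.
apply: etrans (chi_clopen alpha O1 O2) (etrans (congr2 *%R IH1 IH2) _).
apply/esym; apply: etrans (congr1 _ (chi_clopen alpha_str O1 O2)) _.
rewrite (cl_clopen O1 O2) (cc_clopen O1 O2) addnACA exprD; exact: mulrACA.
Qed.

End DualityOfCharacters.

Theorem theorem38 (K : fieldType) (K_char0 : [pchar K] =i pred0)
    (ehr ehr_str : {linear Hqp K -> {poly K}})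
    (ehrP : is_ehr ehr) (ehr_strP : is_ehr_str ehr_str) :
  (forall (A : finType) (P : qposet A),
     ehr_str (qb P) = (-1) ^+ cl P *: (ehr (qb P) \Po (- 'X)))
  /\
  (forall (phi0 : {lrmorphism Hqp K -> {poly K}})
          (lambda alpha alpha_str : character K),
     is_phi0 phi0 ->
     (forall (A : finType) (P : qposet A),
        phi0 (qb P) = lambda (qb P) *: 'X^(cl P)) ->
     ehr =1 leftact phi0 alpha ->
     ehr_str =1 leftact phi0 alpha_str ->
     (forall (A : finType) (P : qposet A),
        alpha (qb P) = (-1) ^+ (cl P + cc P) * alpha_str (qb P))
     /\
     (exists beta : character K, is_inverse alpha beta)
     /\
     (forall beta : character K, is_inverse alpha beta ->
        forall (A : finType) (P : qposet A),
          beta (qb P) = (-1) ^+ (cl P + cc P) * lambda (qb P)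
          /\
          beta (qb P) = (-1) ^+ (cl P + cc P) * ((mu P)%:R / (cl P)`!%:R))).
Proof.
have duality (A : finType) (P : qposet A) :
    ehr_str (qb P) = (-1) ^+ cl P *: (ehr (qb P) \Po (- 'X)).
  by apply: ehrhart_reciprocity => // k; [apply: ehrP|apply: ehr_strP].
split=> // phi0 lambda alpha alpha_str [_ _ phi0_total] phi0E ehrE ehr_strE.
have beta_inv := sign_twist_conv phi0E ehrE ehr_strP duality.
split; [|split].
- exact: (alpha_alpha_str phi0_total phi0E ehrE ehr_strE duality).
- exists (sign_twist lambda).
  exact: (left_inverse_is_inverse phi0_total phi0E ehrP ehrE beta_inv).
move=> beta [_ beta_alpha] A P.
have betaE : beta (qb P) = (-1) ^+ (cl P + cc P) * lambda (qb P).
  rewrite -sign_twist_qb; apply: (conv_inj phi0_total phi0E ehrP ehrE) => h.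
  by rewrite beta_alpha beta_inv.
by rewrite -(lambda_mu phi0_total phi0E ehrP ehrE K_char0).
Qed.
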